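(* Let $N\ge 3$, let $\lambda_1,\dots,\lambda_N>0$ with $\sum_{i=1}^N\lambda_i=1$, let $S,Y\subseteq\mathbb R^n$ be compact, let $\rho\in\mathcal P_{\mathrm{ac}}(S)$, let $\mu_2,\dots,\mu_N\in\mathcal P(Y)$, and let $(T_2,\dots,T_N)$ be the multi-marginal optimal transport maps associated with $(\rho,\mu_2,\dots,\mu_N)$. Let $\sigma$ be a permutation of $\{2,\dots,N\}$ such that $\lambda_{\sigma(i)}=\lambda_i$ for $i=2,\dots,N$. Then there exists a constant $C>0$, depending only on $N$ and $\operatorname{diam}(S\cup Y)$, such that $$\sum_{i=2}^N\lambda_i\|T_i-T_{\sigma(i)}\|_{L^2(\rho)}\le C\Big(\sum_{i=2}^N\lambda_iW_1(\mu_i,\mu_{\sigma(i)})\Big)^{1/2}.\qquad(1)$$ In particular, if $i,j\in\{2,\dots,N\}$ and $\lambda_i=\lambda_j$, then $$\|T_i-T_j\|_{L^2(\rho)}\le C(\lambda_i+\lambda_j)^{-1/2}W_1^{1/2}(\mu_i,\mu_j).\qquad(2)$$ Moreover: (i) the exponent $\frac12$ is optimal in every dimension $n\ge1$: for every $n\ge1$, $N\ge3$ and $\alpha>\frac12$, neither (1) with the exponent $\frac12$ on its right-hand side replaced by $\alpha$, nor (2) with $W_1^{1/2}$ replaced by $W_1^{\alpha}$, holds with a constant depending only on $N$ and $\operatorname{diam}(S\cup Y)$ for all weights $\lambda_1,\dots,\lambda_N>0$ with $\sum_{i=1}^N\lambda_i=1$, all compact sets $S,Y\subseteq\mathbb R^n$,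 all $\rho\in\mathcal P_{\mathrm{ac}}(S)$, all $\mu_2,\dots,\mu_N\in\mathcal P(Y)$ (with $(T_2,\dots,T_N)$ the multi-marginal optimal transport maps associated with $(\rho,\mu_2,\dots,\mu_N)$) and, in the case of (1), all permutations $\sigma$ of $\{2,\dots,N\}$ with $\lambda_{\sigma(k)}=\lambda_k$ for $k=2,\dots,N$, respectively, in the case of (2), all $i,j\in\{2,\dots,N\}$ with $\lambda_i=\lambda_j$; (ii) in dimension $n\ge2$, if one keeps the exponent $\frac12$ in $W_1(\mu_i,\mu_j)$, then the power $-\frac12$ of $(\lambda_i+\lambda_j)$ is optimal: for every $n\ge2$, $N\ge3$ and $\beta>-\frac12$, the inequality $\|T_i-T_j\|_{L^2(\rho)}\le C(\lambda_i+\lambda_j)^{\beta}W_1^{1/2}(\mu_i,\mu_j)$ does not hold with a constant $C$ depending only on $N$ and $\operatorname{diam}(S\cup Y)$ for all weights $\lambda_1,\dots,\lambda_N>0$ with $\sum_{i=1}^N\lambda_i=1$, all compact sets $S,Y\subseteq\mathbb R^n$, all $\rho\in\mathcal P_{\mathrm{ac}}(S)$, all $\mu_2,\dots,\mu_N\in\mathcal P(Y)$ (with $(T_2,\dots,T_N)$ the multi-marginal optimal transport maps associated with $(\rho,\mu_2,\dots,\mu_N)$) and all $i,j\in\{2,\dots,N\}$ with $\lambda_i=\lambda_j$.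
   Context: $\mathcal P(E)$ is the set of Borel probability measures on $E$; $\mathcal P_{\mathrm{ac}}(S)$ is the set of probability measures on $S$ absolutely continuous with respect to the Lebesgue measure $\mathcal L^n$. $W_1$ is the 1-Wasserstein distance for the Euclidean distance, and $W_1^{\theta}(\mu,\nu)=(W_1(\mu,\nu))^{\theta}$. The barycentric quadratic cost is $c(x_1,\dots,x_N)=\inf_{y\in\mathbb R^n}\sum_{i=1}^N\frac{\lambda_i}{2}|x_i-y|^2=\frac12\sum_{1\le i<j\le N}\lambda_i\lambda_j|x_i-x_j|^2$. Given $\rho\in\mathcal P_{\mathrm{ac}}(S)$ and $\mu_2,\dots,\mu_N\in\mathcal P(Y)$, the multi-marginal optimal transport maps associated with $(\rho,\mu_2,\dots,\mu_N)$ are the ($\rho$-a.e. unique, by a theorem of Gangbo and Święch) minimizers $(T_2,\dots,T_N)$ of $\int_S c(x_1,T_2(x_1),\dots,T_N(x_1))\,d\rho(x_1)$ among maps $T_i:S\to Y$ with $(T_i)_\#\rho=\mu_i$, $i=2,\dots,N$. *)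

(* Defs.v *)
From HB Require Import structures.
From mathcomp Require Import all_boot all_order all_algebra.
From mathcomp Require Import perm.
From mathcomp Require Import all_classical all_reals all_analysis.
Set Implicit Arguments.
Unset Strict Implicit.
Unset Printing Implicit Defensive.
Import Order.TTheory GRing.Theory Num.Theory.
Import numFieldNormedType.Exports.
Local Open Scope classical_set_scope.
Local Open Scope ring_scope.

(* R^n with its Borel sigma-algebra.  The carrier is 'rV[R]_n, whose library
   topology is the product topology (its library norm is the sup norm, so the
   Euclidean distance is defined separately below). *)
Notation borelRn R n := (g_sigma_algebraType (@open 'rV[R]_n)).

Definition eucl_dist (R : realType) (n : nat) (x y : 'rV[R]_n) : R :=
  Num.sqrt (\sum_(l < n) (x ord0 l - y ord0 l) ^+ 2).

Definition eucl_diam (R : realType) (n : nat) (A : set 'rV[R]_n) : R :=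
  sup [set eucl_dist p.1 p.2 | p in A `*` A].

Definition box (R : realType) (n : nat) (a b : 'rV[R]_n) : set 'rV[R]_n :=
  [set x | forall l, a ord0 l <= x ord0 l <= b ord0 l].

(* The maximum makes the volume 0 when the box is empty. *)
Definition box_volume (R : realType) (n : nat) (a b : 'rV[R]_n) : R :=
  \prod_(l < n) Num.max 0 (b ord0 l - a ord0 l).

(* n-dimensional Lebesgue (outer) measure, for n >= 1; on Borel sets it is the
   Lebesgue measure L^n. *)
Definition lebesgueRn (R : realType) (n : nat) (A : set (borelRn R n)) :
    \bar R :=
  ereal_inf [set (\sum_(0 <= j <oo) (box_volume (ab j).1 (ab j).2)%:E)%E |
             ab in [set ab : nat -> 'rV[R]_n * 'rV[R]_n |
                    A `<=` \bigcup_j box (ab j).1 (ab j).2]].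

Definition coupling (R : realType) (n : nat)
    (mu nu : probability (borelRn R n) R) :
    set (probability (borelRn R n * borelRn R n)%type R) :=
  [set pi | forall A, measurable A ->
     pushforward pi fst A = mu A /\ pushforward pi snd A = nu A].

Definition wasserstein1 (R : realType) (n : nat)
    (mu nu : probability (borelRn R n) R) : \bar R :=
  ereal_inf [set (\int[pi]_z (eucl_dist z.1 z.2)%:E)%E |
             pi in coupling mu nu].

(* With N = k.+1 marginals, the indices 1, ..., N are the elements of 'I_k.+1
   and the indices 2, ..., N (those of the targets mu_i and the maps T_i) are
   the elements of 'I_k, embedded in 'I_k.+1 by lift ord0. *)
Definition bary_cost (R : realType) (k n : nat) (lam : 'I_k.+1 -> R)
    (x : 'I_k.+1 -> 'rV[R]_n) : R :=
  inf [set \sum_i lam i / 2 * eucl_dist (x i) y ^+ 2 | y in [set: 'rV[R]_n]].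

(* The N-tuple (x1, T_2 x1, ..., T_N x1). *)
Definition graph_point (R : realType) (k n : nat)
    (T : 'I_k -> borelRn R n -> borelRn R n) (x1 : borelRn R n)
    (i : 'I_k.+1) : 'rV[R]_n :=
  if unlift ord0 i is Some j then T j x1 else x1.

(* A Borel map S -> Y is represented by a Borel map R^n -> R^n sending S to Y;
   every Borel map from the closed set S to Y has such an extension, and its
   values off S are irrelevant since rho S = 1. *)
Record transport_maps (R : realType) (k n : nat) (S Y : set (borelRn R n))
    (rho : probability (borelRn R n) R)
    (mu : 'I_k -> probability (borelRn R n) R)
    (T : 'I_k -> borelRn R n -> borelRn R n) : Prop := TransportMaps {
  transport_measurable : forall i, measurable_fun [set: borelRn R n] (T i) ;
  transport_range : forall i x, S x -> Y (T i x) ;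
  transport_pushforward : forall i A, measurable A ->
    pushforward rho (T i) A = mu i A }.

Definition mm_cost (R : realType) (k n : nat) (lam : 'I_k.+1 -> R)
    (S : set (borelRn R n)) (rho : probability (borelRn R n) R)
    (T : 'I_k -> borelRn R n -> borelRn R n) : \bar R :=
  (\int[rho]_(x in S) (bary_cost lam (graph_point T x))%:E)%E.

Definition mm_optimal_maps (R : realType) (k n : nat) (lam : 'I_k.+1 -> R)
    (S Y : set (borelRn R n)) (rho : probability (borelRn R n) R)
    (mu : 'I_k -> probability (borelRn R n) R)
    (T : 'I_k -> borelRn R n -> borelRn R n) : Prop :=
  transport_maps S Y rho mu T /\
  forall T', transport_maps S Y rho mu T' ->
    (mm_cost lam S rho T <= mm_cost lam S rho T')%E.

(* A probability measure on a compact set S is represented by a Borel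
   probability measure on R^n giving mass 1 to S. *)
Record mm_setting (R : realType) (k n : nat) (lam : 'I_k.+1 -> R)
    (S Y : set 'rV[R]_n) (rho : probability (borelRn R n) R)
    (mu : 'I_k -> probability (borelRn R n) R)
    (T : 'I_k -> borelRn R n -> borelRn R n) : Prop := MMSetting {
  weights_gt0 : forall i, 0 < lam i ;
  weights_sum1 : \sum_i lam i = 1 ;
  source_compact : compact S ;
  target_compact : compact Y ;
  rho_on_source : rho S = 1%E ;
  rho_abs_continuous : rho `<< @lebesgueRn R n ;
  mu_on_target : forall i, mu i Y = 1%E ;
  maps_optimal : mm_optimal_maps lam S Y rho mu T }.

Definition L2_dist (R : realType) (n : nat)
    (rho : probability (borelRn R n) R)
    (f g : borelRn R n -> borelRn R n) : \bar R :=
  ('N[rho]_2%:E [(fun x => (eucl_dist (f x) (g x))%:E)])%E.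

Definition permutation_estimate (R : realType) (k n : nat)
    (C : R -> R) (alpha : R) : Prop :=
  forall (lam : 'I_k.+1 -> R) (S Y : set 'rV[R]_n)
    (rho : probability (borelRn R n) R)
    (mu : 'I_k -> probability (borelRn R n) R)
    (T : 'I_k -> borelRn R n -> borelRn R n) (sigma : {perm 'I_k}),
    mm_setting lam S Y rho mu T ->
    (forall i, lam (lift ord0 (sigma i)) = lam (lift ord0 i)) ->
    (\sum_(i < k) (lam (lift ord0 i))%:E * L2_dist rho (T i) (T (sigma i))
      <= (C (eucl_diam (S `|` Y)))%:E *
         (\sum_(i < k) (lam (lift ord0 i))%:E *
            wasserstein1 (mu i) (mu (sigma i))) `^ alpha)%E.

Definition pair_estimate (R : realType) (k n : nat)
    (C : R -> R) (beta alpha : R) : Prop :=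
  forall (lam : 'I_k.+1 -> R) (S Y : set 'rV[R]_n)
    (rho : probability (borelRn R n) R)
    (mu : 'I_k -> probability (borelRn R n) R)
    (T : 'I_k -> borelRn R n -> borelRn R n) (i j : 'I_k),
    mm_setting lam S Y rho mu T ->
    lam (lift ord0 i) = lam (lift ord0 j) ->
    (L2_dist rho (T i) (T j)
      <= (C (eucl_diam (S `|` Y)) *
          (lam (lift ord0 i) + lam (lift ord0 j)) `^ beta)%:E *
         wasserstein1 (mu i) (mu j) `^ alpha)%E.

(* Main.v *)
Require Import Defs.
From HB Require Import structures.
From mathcomp Require Import all_boot all_order all_algebra.
From mathcomp Require Import perm.
From mathcomp Require Import all_classical all_reals all_analysis.
From mathcomp Require Import measurable_realfun.
From mathcomp Require Import ring lra.
Set Implicit Arguments.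
Unset Strict Implicit.
Unset Printing Implicit Defensive.
Import Order.TTheory GRing.Theory Num.Theory.
Import numFieldNormedType.Exports.
Local Open Scope classical_set_scope.
Local Open Scope ring_scope.

(** Why the theorem holds.

    Expanding the cost around a point [y0] ([bary_costE]) shows that, once the
    marginals are fixed, minimising it amounts to maximising the mean of
    [esq u], where [u] is the barycenter of [x, T_2 x, ..., T_N x] relative to
    [y0]. Replacing one map [T_i] by another map [Ti] with the same law adds
    [w (Ti - T_i)] to [u], [w] being the weight, so optimality says that the mean
    of [2 u . (Ti - T_i) + w |Ti - T_i|^2] is nonpositive
    ([optimal_perturbation]). If [T_i] and [T_j] have the same weight, take for
    [Ti] a map of law [mu_i] close to [T_j], and for [Tj] a map of law [mu_j] close
    to [T_i]. The two linear terms nearly cancel, the two quadratic ones add up to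
    nearly twice [w |T_i - T_j|^2] ([swap_displacements_ge]), and the errors are of
    the order of the diameter times the mean distances of [Ti] to [T_j] and of [Tj]
    to [T_i]. Hence [w ||T_i - T_j||^2 <= 4 D W_1(mu_i, mu_j)] ([pair_energy_le]),
    provided these mean distances can be made as close to [W_1(mu_i, mu_j)] as
    desired. Both estimates follow from this inequality; the one with a
    permutation only uses it for the pairs [i, sigma i].

    The competitors must be maps, whereas [W_1] is an infimum over couplings, so
    couplings have to be approximated by maps with exact second marginal
    ([coupling_map]). As [rho] is absolutely continuous it charges no hyperplane,
    and any event can be split in arbitrary proportions ([atomless_split]). One
    codes [T_i] up to a small error by an integer, then appends one after the other
    the binary digits of a vector of law [mu_j], splitting events so that the
    integer and the digits always have the joint law prescribed by the coupling
    ([same_law_refine], [same_law_bits]). The infinite sequence of digits defines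
    the map ([same_law_realize], [eq_law_of_approx]).

    For the optimality of the exponents, maps which minimise the cost pointwise,
    among all targets allowed by the supports of the marginals, are optimal
    ([mm_setting_of_pointwise]). In [first_example] all targets are Dirac masses at
    0 except one, which has an additional mass [eps] at distance of order 1: then
    [W_1] is of order [eps] and the L2 distance of order [eps ^ (1/2)]. In
    [second_example], where two targets have a small weight [t], the source is,
    in the plane of two coordinates, close to the vertical axis and away from the
    horizontal one; the two targets are
    pairs of opposite points, almost horizontal and mirror images of one another.
    The sign of the vertical coordinate decides which point is reached, and the
    two maps send almost every [x] to almost opposite points, although [W_1] is of
    order [t]. *)

(** * Euclidean geometry and the barycentric cost *)

Section euclid.
Variables (R : realType) (n : nat).
Implicit Types (u v w x y z : 'rV[R]_n) (a b : R).

Definition edot u v : R := \sum_(l < n) u ord0 l * v ord0 l.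
Definition esq u : R := edot u u.

Lemma edotC u v : edot u v = edot v u.
Proof. by apply: eq_bigr => l _; rewrite mulrC. Qed.

Lemma edotDl u v w : edot (u + v) w = edot u w + edot v w.
Proof. by rewrite -big_split; apply: eq_bigr => l _; rewrite mxE mulrDl. Qed.

Lemma edotNl u w : edot (- u) w = - edot u w.
Proof.
by rewrite -[RHS]mulN1r mulr_sumr; apply: eq_bigr => l _; rewrite mxE mulN1r mulNr.
Qed.

Lemma edotZl a u w : edot (a *: u) w = a * edot u w.
Proof. by rewrite mulr_sumr; apply: eq_bigr => l _; rewrite mxE mulrA. Qed.

Lemma edotDr u v w : edot w (u + v) = edot w u + edot w v.
Proof. by rewrite edotC edotDl !(edotC w). Qed.

Lemma edotNr u w : edot w (- u) = - edot w u.
Proof. by rewrite edotC edotNl (edotC w). Qed.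

Lemma edotZr a u w : edot w (a *: u) = a * edot w u.
Proof. by rewrite edotC edotZl (edotC w). Qed.

Definition edotE := (edotDl, edotDr, edotNl, edotNr, edotZl, edotZr).

Lemma edot_suml (I : finType) (f : I -> 'rV[R]_n) w :
  edot (\sum_i f i) w = \sum_i edot (f i) w.
Proof.
rewrite /edot exchange_big; apply: eq_bigr => l _.
by rewrite summxE mulr_suml.
Qed.

Lemma esq_ge0 u : 0 <= esq u.
Proof. by apply: sumr_ge0 => l _; rewrite -expr2 sqr_ge0. Qed.

Lemma esq0 : esq 0 = 0.
Proof. by apply: big1 => l _; rewrite mxE mul0r. Qed.

Lemma eucl_distE x y : eucl_dist x y = Num.sqrt (esq (x - y)).
Proof.
by congr Num.sqrt; apply: eq_bigr => l _; rewrite !mxE expr2.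
Qed.

Lemma sqr_eucl_dist x y : eucl_dist x y ^+ 2 = esq (x - y).
Proof. by rewrite eucl_distE sqr_sqrtr// esq_ge0. Qed.

Lemma eucl_dist_ge0 x y : 0 <= eucl_dist x y.
Proof. exact: sqrtr_ge0. Qed.

Lemma eucl_distC x y : eucl_dist x y = eucl_dist y x.
Proof.
by rewrite !eucl_distE -(opprB y) /esq edotNl edotNr opprK.
Qed.

Lemma eucl_dist_refl x : eucl_dist x x = 0.
Proof. by rewrite eucl_distE subrr esq0 sqrtr0. Qed.

(** Cauchy-Schwarz, from [0 <= esq (esq v *: u - edot u v *: v)]. *)
Lemma edot_sqr_le u v : edot u v ^+ 2 <= esq u * esq v.
Proof.
have [v0|v0] := eqVneq (esq v) 0.
  have sq_ge0 l : true -> 0 <= v ord0 l * v ord0 l by rewrite -expr2 sqr_ge0.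
  have v00 l : v ord0 l = 0.
    have /psumr_eq0P H := v0.
    by move/eqP: (H sq_ge0 l isT); rewrite mulf_eq0 orbb => /eqP.
  rewrite v0 mulr0 (_ : edot u v = 0) ?expr0n//.
  by apply: big1 => l _; rewrite v00 mulr0.
have vpos : 0 < esq v by rewrite lt_def v0 esq_ge0.
have := esq_ge0 (esq v *: u - edot u v *: v).
rewrite {1}/esq !edotE -/(esq u) -/(esq v) (edotC v u).
move=> H; rewrite -(ler_pM2l vpos) -subr_ge0; apply: le_trans H _.
by rewrite le_eqVlt; apply/orP; left; apply/eqP; ring.
Qed.

Lemma edot_le u v : `|edot u v| <= Num.sqrt (esq u) * Num.sqrt (esq v).
Proof.
rewrite -sqrtrM ?esq_ge0// -sqrtr_sqr ler_wsqrtr// edot_sqr_le//.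
Qed.

Lemma esqrt_triangle u v :
  Num.sqrt (esq (u + v)) <= Num.sqrt (esq u) + Num.sqrt (esq v).
Proof.
rewrite -[leRHS]ger0_norm ?addr_ge0 ?sqrtr_ge0// -sqrtr_sqr ler_wsqrtr//.
rewrite sqrrD !sqr_sqrtr ?esq_ge0// {1}/esq !edotE -/(esq u) -/(esq v) (edotC v).
have := edot_le u v; rewrite ler_norml => /andP[_]; lra.
Qed.

Lemma eucl_dist_triangle x y z : eucl_dist x z <= eucl_dist x y + eucl_dist y z.
Proof.
by rewrite !eucl_distE (_ : x - z = (x - y) + (y - z)) ?esqrt_triangle// addrA subrK.
Qed.

Lemma eucl_dist_le_coord x y e : 0 <= e ->
  (forall l, `|x ord0 l - y ord0 l| <= e) -> eucl_dist x y <= n%:R * e.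
Proof.
move=> e0 h; rewrite /eucl_dist -[leRHS]ger0_norm ?mulr_ge0// -sqrtr_sqr ler_wsqrtr//.
case: n x y h => [|m] x y h; first by rewrite big_ord0 sqr_ge0.
apply: le_trans (_ : \sum_(l < m.+1) e ^+ 2 <= _).
  by apply: ler_sum => l _; rewrite -real_normK ?num_real// lerXn2r ?nnegrE.
rewrite sumr_const card_ord exprMn -(mulr_natl (e ^+ 2)) ler_wpM2r ?sqr_ge0//.
by rewrite expr2 -natrM ler_nat leq_pmulr.
Qed.

Lemma edot_subr_ge u x y (D : R) : Num.sqrt (esq u) <= D ->
  - (D * eucl_dist x y) <= edot u (x - y).
Proof.
move=> uD; have := edot_le u (x - y); rewrite ler_norml => /andP[+ _].
by apply: le_trans; rewrite eucl_distE lerN2 ler_wpM2r ?sqrtr_ge0.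
Qed.

Lemma esq_subr_ge (a b c : 'rV[R]_n) (D : R) : eucl_dist b a <= D ->
  esq (b - a) - 2 * (D * eucl_dist c b) <= esq (c - a).
Proof.
rewrite eucl_distE => baD.
have -> : c - a = (b - a) + (c - b) by rewrite [RHS]addrC addrA subrK.
have := edot_subr_ge c b baD; have := esq_ge0 (c - b).
move: (b - a) (c - b) => p r; rewrite [esq (p + r)]/esq !edotE (edotC r p) -!/(esq _).
lra.
Qed.

(** Two points [a], [b] are moved, [a] to a point [a'] close to [b] and [b] to a
point [b'] close to [a]. The two displacements are nearly opposite, so their
scalar products with [u] nearly cancel, while the sum of their squares is nearly
twice [esq (a - b)]. *)
Lemma swap_displacements_ge (u a b a' b' : 'rV[R]_n) (D w : R) : Num.sqrt (esq u) <= D ->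
  eucl_dist a b <= D -> 0 <= w -> w <= 1 ->
  2 * w * esq (a - b) - 4 * D * (eucl_dist b a' + eucl_dist a b') <=
  (2 * edot u (a' - a) + w * esq (a' - a)) +
  (2 * edot u (b' - b) + w * esq (b' - b)).
Proof.
move=> uD abD w0 w1; have baD : eucl_dist b a <= D by rewrite eucl_distC.
have D0 : 0 <= D := le_trans (eucl_dist_ge0 a b) abD.
have du : edot u (a' - a) + edot u (b' - b) = edot u (a' - b) + edot u (b' - a).
  by rewrite !edotE; ring.
have d1 := edot_subr_ge a' b uD; have d2 := edot_subr_ge b' a uD.
have q1 := ler_wpM2l w0 (esq_subr_ge a' baD).
have q2 := ler_wpM2l w0 (esq_subr_ge b' abD).
have sqC : esq (b - a) = esq (a - b) by rewrite -!sqr_eucl_dist eucl_distC.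
rewrite sqC (eucl_distC a' b) in q1; rewrite (eucl_distC b' a) in q2.
rewrite (eucl_distC a' b) in d1; rewrite (eucl_distC b' a) in d2.
have E0 : 0 <= D * eucl_dist b a' + D * eucl_dist a b'.
  by rewrite addr_ge0// mulr_ge0 ?eucl_dist_ge0.
have := ler_wpM2r E0 w1; move: q1 q2 d1 d2 du.
rewrite !(mulrBr w) !(mulrCA w 2) mulrDr mul1r -!(mulrA 2 w) -(mulrA 4) mulrDr.
move: (w * (D * eucl_dist b a')) (w * (D * eucl_dist a b')) (w * esq (a - b)) => A B E.
move: (D * _) (D * _) (w * _) (w * _) => A' B' X1 X2; lra.
Qed.

End euclid.

(** The infimum is reached at the barycenter: the sum over the marginals of the
weighted squared distances to [y] equals its value there plus
[esq (y - barycenter) / 2]. Expanding around an arbitrary centre [y0] separates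
a part depending on each marginal alone from the square of the barycenter. *)
Lemma bary_costE (R : realType) (k n : nat) (lam : 'I_k.+1 -> R)
    (x : 'I_k.+1 -> 'rV[R]_n) (y0 : 'rV[R]_n) : \sum_i lam i = 1 ->
  bary_cost lam x = 2^-1 * \sum_i lam i * esq (x i - y0)
     - 2^-1 * esq (\sum_i lam i *: (x i - y0)).
Proof.
move=> lam1; set b := \sum_i _ *: _.
have expand y : \sum_i lam i / 2 * eucl_dist (x i) y ^+ 2 =
    2^-1 * \sum_i lam i * esq (x i - y0) - 2^-1 * esq b
      + 2^-1 * esq (y - y0 - b).
  have -> : \sum_i lam i / 2 * eucl_dist (x i) y ^+ 2 =
     2^-1 * \sum_i lam i * esq (x i - y0) - edot b (y - y0)
      + 2^-1 * (\sum_i lam i) * esq (y - y0).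
    transitivity (\sum_i (2^-1 * (lam i * esq (x i - y0))
        - lam i * edot (x i - y0) (y - y0) + lam i * (2^-1 * esq (y - y0)))).
      apply: eq_bigr => i _; rewrite sqr_eucl_dist.
      rewrite (_ : x i - y = (x i - y0) - (y - y0)); last first.
        by rewrite opprB addrA subrK.
      move: (x i - y0) (y - y0) => p q.
      rewrite [esq (p - q)]/esq !edotE (edotC q p) -!/(esq _); by field.
    have -> : edot b (y - y0) = \sum_i lam i * edot (x i - y0) (y - y0).
      by rewrite edot_suml; apply: eq_bigr => i _; rewrite edotZl.
    rewrite big_split sumrB /= -mulr_sumr -mulr_suml.
    by rewrite mulrA (mulrC (\sum_i _) 2^-1).
  rewrite lam1 mulr1.
  move: (y - y0) => q; rewrite [esq (q - b)]/esq !edotE (edotC q b) -!/(esq _); by field.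
rewrite /bary_cost; set A := [set _ | _ in _].
have lbA : lbound A (2^-1 * \sum_i lam i * esq (x i - y0) - 2^-1 * esq b).
  by move=> _ [y _ <-]; rewrite expand lerDl mulr_ge0 ?esq_ge0 ?invr_ge0.
have Ab : A (2^-1 * \sum_i lam i * esq (x i - y0) - 2^-1 * esq b).
  exists (y0 + b) => //; rewrite expand.
  have -> : y0 + b - y0 - b = 0 by rewrite -addrA -opprD subrr.
  by rewrite esq0 mulr0 addr0.
apply/eqP; rewrite eq_le; apply/andP; split.
  exact: (ge_inf (ex_intro _ _ lbA) Ab).
exact: (lb_le_inf (ex_intro _ _ Ab) lbA).
Qed.

(** * Measurability in R^n *)

Section borel.
Variables (R : realType) (n : nat).

Lemma measurable_open_rV (U : set 'rV[R]_n) : open U ->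
  measurable (U : set (borelRn R n)).
Proof. exact: sub_sigma_algebra. Qed.

Lemma measurable_closed_rV (U : set 'rV[R]_n) : closed U ->
  measurable (U : set (borelRn R n)).
Proof.
by move=> /closed_openC oU; rewrite -(setCK U); apply: measurableC; exact: measurable_open_rV.
Qed.

Lemma measurable_compact_rV (U : set 'rV[R]_n) : compact U ->
  measurable (U : set (borelRn R n)).
Proof.
move=> cU; apply: measurable_closed_rV.
exact: (compact_closed (@norm_hausdorff R 'rV[R]_n) cU).
Qed.

Lemma measurable_coord (l : 'I_n) :
  measurable_fun setT (fun x : borelRn R n => (x : 'rV[R]_n) ord0 l).
Proof.
apply: (measurability _ (RGenOpens.measurableE R)) .
move=> _ [_ [a [b ->] <-]].
rewrite setTI; apply: measurable_open_rV.
have /continuousP := @coord_continuous R 1 n ord0 l; apply.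
exact: interval_open.
Qed.

(** Every open set is a countable union of rational cubes, so measurability
into R^n can be checked on coordinates. *)
Lemma measurable_to_rV d (T : measurableType d) (f : T -> borelRn R n) :
  (forall l, measurable_fun setT (fun t => (f t : 'rV[R]_n) ord0 l)) ->
  measurable_fun setT f.
Proof.
move=> mf; apply: (@measurability _ _ T (borelRn R n) setT f (@open 'rV[R]_n)) => //.
move=> _ [U oU <-]; rewrite setTI.
pose B (p : 'rV[rat]_n * rat) : set 'rV[R]_n :=
  [set y | forall l, `|ratr (p.1 ord0 l) - y ord0 l| < ratr p.2].
have -> : f @^-1` U = \bigcup_p [set t | B p `<=` U /\ B p (f t)].
  apply/seteqP; split => [t /= Uft|t [p _ [/= BU /BU]]//].
  have /nbhs_ballP[e /= e0 eU] : nbhs (f t : 'rV[R]_n) U.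
    by apply: open_nbhs_nbhs; split.
  have [r] : exists r : rat, ratr r \in `](e / 4), (e / 2)[.
    by apply: rat_in_itvoo; lra.
  rewrite in_itv /= => /andP[r1 r2].
  have hq l : exists q : rat, `|ratr q - (f t : 'rV[R]_n) ord0 l| < ratr r.
    have [q] : exists q : rat, ratr q \in `](((f t : 'rV[R]_n) ord0 l) - ratr r),
        (((f t : 'rV[R]_n) ord0 l) + ratr r)[.
      by apply: rat_in_itvoo; lra.
    rewrite in_itv /= => /andP[q1 q2]; exists q.
    by rewrite ltr_norml; apply/andP; split; lra.
  have [q qP] := choice hq.
  exists (\row_l q l, r) => //=; split => [y /= By|/= l]; last by rewrite mxE.
  apply: eU; split => // i l; rewrite ord1.
  rewrite -ball_normE /=.
  have /= := By l; rewrite mxE => h1.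
  have h2 := qP l.
  have -> : (f t : 'rV[R]_n) ord0 l - y ord0 l =
    (ratr (q l) - y ord0 l) - (ratr (q l) - (f t : 'rV[R]_n) ord0 l) by lra.
  apply: le_lt_trans (ler_normB _ _) _; lra.
apply: countable_bigcupT_measurable => // p.
have [pU|npU] := pselect (B p `<=` U); last first.
  by rewrite (_ : [set t | _] = set0)//; apply/seteqP; split => [t []|].
rewrite (_ : [set t | _] = \bigcap_(l in [set: 'I_n])
   ((fun t => (f t : 'rV[R]_n) ord0 l) @^-1`
      [set z | `|ratr (p.1 ord0 l) - z| < ratr p.2])).
  apply: fin_bigcap_measurable => // l _.
  rewrite -[X in measurable X]setTI; apply: mf => //.
  rewrite (_ : [set z | _] = `]ratr (p.1 ord0 l) - ratr p.2,
      ratr (p.1 ord0 l) + ratr p.2[%classic); first exact: measurable_itv.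
  apply/seteqP; split => z /=; rewrite ltr_norml in_itv /= => /andP[? ?];
    by apply/andP; split; lra.
apply/seteqP; split => [t [_ Bt] l _|t Bt]; first exact: Bt.
by split => // l; exact: Bt.
Qed.

Section dist.
Context d (T : measurableType d).
Implicit Types f g : T -> borelRn R n.

Lemma measurable_coord_comp f l : measurable_fun setT f ->
  measurable_fun setT (fun t => (f t : 'rV[R]_n) ord0 l).
Proof.
move=> mf; exact: (measurableT_comp (measurable_coord l) mf).
Qed.

Lemma measurable_addv f g : measurable_fun setT f -> measurable_fun setT g ->
  measurable_fun setT ((fun t => (f t : 'rV[R]_n) + g t) : T -> borelRn R n).
Proof.
move=> mf mg; apply: measurable_to_rV => l.
under eq_fun do rewrite mxE.
by apply: measurable_funD; exact: measurable_coord_comp.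
Qed.

Lemma measurable_scalev f (a : R) : measurable_fun setT f ->
  measurable_fun setT ((fun t => a *: (f t : 'rV[R]_n)) : T -> borelRn R n).
Proof.
move=> mf; apply: measurable_to_rV => l.
under eq_fun do rewrite mxE.
by apply: measurable_funM => //; exact: measurable_coord_comp.
Qed.

Lemma measurable_subv f g : measurable_fun setT f -> measurable_fun setT g ->
  measurable_fun setT ((fun t => (f t : 'rV[R]_n) - g t) : T -> borelRn R n).
Proof.
move=> mf mg; apply: measurable_addv => //.
under eq_fun do rewrite -scaleN1r.
exact: measurable_scalev.
Qed.

Lemma measurable_sumv (I : finType) (f : I -> T -> borelRn R n) :
  (forall i, measurable_fun setT (f i)) ->
  measurable_fun setT ((fun t => \sum_i (f i t : 'rV[R]_n)) : T -> borelRn R n).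
Proof.
move=> mf; apply: measurable_to_rV => l.
under eq_fun do rewrite summxE.
by apply: measurable_sum => i; exact: measurable_coord_comp.
Qed.

Lemma measurable_edot f g : measurable_fun setT f -> measurable_fun setT g ->
  measurable_fun setT (fun t => edot (f t) (g t)).
Proof.
move=> mf mg; apply: measurable_sum => l.
by apply: measurable_funM; exact: measurable_coord_comp.
Qed.

Lemma measurable_esq f : measurable_fun setT f ->
  measurable_fun setT (fun t => esq (f t)).
Proof. by move=> mf; exact: measurable_edot. Qed.

Lemma measurable_eucl_dist f g : measurable_fun setT f -> measurable_fun setT g ->
  measurable_fun setT (fun t => eucl_dist (f t) (g t)).
Proof.
move=> mf mg; under eq_fun do rewrite eucl_distE.
apply: (@measurableT_comp _ _ _ _ _ _ (@Num.sqrt R)).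
  by apply: continuous_measurable_fun; exact: sqrt_continuous.
by apply: measurable_esq; exact: measurable_subv.
Qed.

End dist.
End borel.

(** * Atomless probabilities *)

Section hyperplane.
Variables (R : realType) (n : nat).

Lemma lebesgueRn_hyperplane (l0 : 'I_n) (t : R) (A : set (borelRn R n)) :
  A `<=` [set x : 'rV[R]_n | x ord0 l0 = t] -> lebesgueRn A = 0%E.
Proof.
move=> At; apply/eqP; rewrite eq_le; apply/andP; split; last first.
  apply: le_ereal_inf_tmp => _ [ab _ <-]; apply: nneseries_ge0 => j _ _.
  by rewrite lee_fin; apply: prodr_ge0 => l _; rewrite le_max lexx.
(* Flat boxes: their side in the direction [l0] is reduced to the point [t]. *)
pose ab (j : nat) : 'rV[R]_n * 'rV[R]_n :=
  (\row_l (if l == l0 then t else - j%:R), \row_l (if l == l0 then t else j%:R)).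
apply: ereal_inf_lbound => /=; exists ab.
  move=> x /At /= xt.
  pose M := \sum_l `|x ord0 l|.
  exists (Num.truncn M).+1 => // l; rewrite !mxE.
  have [->|ll0] := eqVneq l l0; first by rewrite xt lexx.
  rewrite -ler_norml; apply: le_trans (_ : M <= _).
    rewrite /M (bigD1 l)//= lerDl; exact: sumr_ge0.
  by apply/ltW/truncnS_gt.
apply: eseries0 => j _ _; congr EFin.
by rewrite /box_volume (bigD1 l0)//= !mxE eqxx subrr maxxx mul0r.
Qed.

Lemma hyperplane_null (rho : probability (borelRn R n) R) (l0 : 'I_n) (t : R) :
  rho `<< @lebesgueRn R n ->
  rho ((fun x : borelRn R n => (x : 'rV[R]_n) ord0 l0) @^-1` [set t]) = 0%E.
Proof.
move=> /(_ ((fun x : borelRn R n => (x : 'rV[R]_n) ord0 l0) @^-1` [set t])); apply => //.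
  by move=> A _ At; exact: (@lebesgueRn_hyperplane l0 t).
by rewrite -[X in measurable X]setTI; apply: measurable_coord.
Qed.

End hyperplane.

Section probability_continuity.
Context d (Om : measurableType d) (R : realType) (P : probability Om R).

Lemma probability_bigcap_ge (F : (set Om)^nat) (m : \bar R) :
  (forall k, measurable (F k)) -> nonincreasing_seq F ->
  (forall k, (m <= P (F k))%E) -> (m <= P (\bigcap_k F k))%E.
Proof.
move=> mF niF mP.
have cvF : P \o F @ \oo --> P (\bigcap_k F k).
  apply: nonincreasing_cvg_mu => //; last exact: bigcapT_measurable.
  exact: le_lt_trans (probability_le1 _ _) (ltry _).
rewrite -(cvg_lim _ cvF)//; apply: lime_ge; first by apply/cvg_ex; eexists; exact: cvF.
by near=> k; exact: mP.
Unshelve. all: by end_near. Qed.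

Lemma probability_bigcup_le (F : (set Om)^nat) (m : \bar R) :
  (forall k, measurable (F k)) -> nondecreasing_seq F ->
  (forall k, (P (F k) <= m)%E) -> (P (\bigcup_k F k) <= m)%E.
Proof.
move=> mF ndF mP.
have cvF : P \o F @ \oo --> P (\bigcup_k F k).
  by apply: nondecreasing_cvg_mu => //; exact: bigcupT_measurable.
rewrite -(cvg_lim _ cvF)//; apply: lime_le; first by apply/cvg_ex; eexists; exact: cvF.
by near=> k; exact: mP.
Unshelve. all: by end_near. Qed.

End probability_continuity.

Section atomless.
Context d (Om : measurableType d) (R : realType) (P : probability Om R).
Variables (X : Om -> R) (mX : measurable_fun setT X).
Hypothesis atomless : forall t, P (X @^-1` [set t]) = 0%E.

(** Continuity of measure makes [t |-> P (E `&` [set w | X w <= t])] continuous,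
so it takes every intermediate value. *)
Lemma atomless_split (E : set Om) (m : \bar R) : measurable E ->
  (0 <= m <= P E)%E -> exists F, [/\ measurable F, F `<=` E & P F = m].
Proof.
move=> mE /andP[m0 mP].
have [->|mPE] := eqVneq m (P E); first by exists E; split.
have [->|m00] := eqVneq m 0%E; first by exists set0; split => //; rewrite measure0.
have mlt : (m < P E)%E by rewrite lt_def eq_sym mPE.
have mgt : (0 < m)%E by rewrite lt_def m00.
pose F t := E `&` X @^-1` `]-oo, t].
pose G t := E `&` X @^-1` `]-oo, t[.
have mF t : measurable (F t).
  by apply: measurableI => //; rewrite -[X in measurable X]setTI; exact: mX.
have mG t : measurable (G t).
  by apply: measurableI => //; rewrite -[X in measurable X]setTI; exact: mX.
have FG t : P (F t) = P (G t).
  apply/eqP; rewrite eq_le; apply/andP; split; last first.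
    apply: le_measure; rewrite ?inE// => w [Ew]; rewrite /= !in_itv/= => /ltW Xw.
    by split => //=; rewrite in_itv.
  apply: le_trans (_ : P (G t `|` X @^-1` [set t]) <= _)%E.
    have mXt : measurable (X @^-1` [set t]).
      by rewrite -[X in measurable X]setTI; exact: mX.
    apply: le_measure; rewrite ?inE//; first exact: measurableU.
    move=> w [Ew]; rewrite /= in_itv/= le_eqVlt => /orP[/eqP Xw|Xw]; first by right.
    by left; split => //=; rewrite in_itv.
  apply: le_trans (measureU2 _ _ _) _ => //.
    by rewrite -[X in measurable X]setTI; exact: mX.
  by rewrite [X in (_ + X <= _)%E](atomless t) adde0.
have F_le s t : s <= t -> F s `<=` F t.
  move=> st w [Ew]; rewrite /= !in_itv/= => Xw.
  by split => //=; rewrite in_itv/=; exact: le_trans Xw st.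
have PF_le s t : s <= t -> (P (F s) <= P (F t))%E.
  by move=> st; apply: le_measure; rewrite ?inE//; exact: F_le.
have [a Fa] : exists a, (P (F a) < m)%E.
  apply: contrapT => /forallNP noa.
  have : (m <= P (\bigcap_k F (- k%:R)%R))%E.
    apply: probability_bigcap_ge => // [i j ij|k].
      by apply/subsetPset/F_le; rewrite lerN2 ler_nat.
    by rewrite leNgt; apply/negP/noa.
  rewrite (_ : \bigcap_k F _ = set0); first by rewrite measure0 leNgt mgt.
  apply/seteqP; split => // w /(_ (Num.truncn `|X w|).+1 I)[_] /=.
  rewrite in_itv/= leNgt => /negP; apply.
  have := truncnS_gt `|X w|; have := ler_norm (- X w); rewrite normrN; lra.
have [b Fb] : exists b, (m < P (F b))%E.
  apply: contrapT => /forallNP nob.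
  have : (P (\bigcup_k F k%:R%R) <= m)%E.
    apply: probability_bigcup_le => // [i j ij|k].
      by apply/subsetPset/F_le; rewrite ler_nat.
    by rewrite leNgt; apply/negP/nob.
  rewrite (_ : \bigcup_k F _ = E); first by rewrite leNgt mlt.
  apply/seteqP; split => [w [k _ []]//|w Ew].
  exists (Num.truncn `|X w|).+1 => //; split => //=; rewrite in_itv/=.
  have := truncnS_gt `|X w|; have := ler_norm (X w); lra.
(* The supremum of the levels [t] at which the mass of [F t] is at most [m]. *)
pose S := [set t | (P (F t) <= m)%E].
have hS : has_sup S.
  split; first by exists a; exact: ltW.
  exists b => t /= Ft; rewrite leNgt; apply/negP => /ltW /PF_le bt.
  by have := lt_le_trans Fb (le_trans bt Ft); rewrite ltxx.
have k1 k : 0 < k.+1%:R^-1 :> R by rewrite invr_gt0.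
have PG : (P (G (sup S)) <= m)%E.
  rewrite (_ : G _ = \bigcup_k F (sup S - k.+1%:R^-1)).
    apply: probability_bigcup_le => // [i j ij|k].
      apply/subsetPset/F_le; rewrite lerD2l lerN2 lef_pV2 ?posrE//.
      by rewrite ler_nat ltnS.
    have [t St kt] := sup_adherent (k1 k) hS.
    exact: le_trans (PF_le _ _ (ltW kt)) St.
  apply/seteqP; split => [w [Ew /=]|w [k _ [Ew /=]]]; rewrite in_itv/= => Xw.
    have sX : 0 < sup S - X w by rewrite subr_gt0.
    exists (Num.truncn (sup S - X w)^-1) => //; split => //=; rewrite in_itv/=.
    have : (Num.truncn (sup S - X w)^-1).+1%:R^-1 <= sup S - X w.
      rewrite -[leRHS]invrK lef_pV2 ?posrE ?invr_gt0//.
      exact/ltW/truncnS_gt.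
    move: (_%:R^-1) => q; lra.
  split => //=; rewrite in_itv/=; apply: le_lt_trans Xw _.
  by rewrite ltrBlDr ltrDl invr_gt0.
have PF : (m <= P (F (sup S)))%E.
  rewrite (_ : F _ = \bigcap_k F (sup S + k.+1%:R^-1)).
    apply: probability_bigcap_ge => // [i j ij|k].
      apply/subsetPset/F_le; rewrite lerD2l lef_pV2 ?posrE//.
      by rewrite ler_nat ltnS.
    rewrite leNgt; apply/negP => /ltW Sk.
    have := sup_upper_bound hS Sk.
    by rewrite leNgt ltrDl invr_gt0 ltr0n.
  apply/seteqP; split => [w [Ew /=]|w Fw].
    rewrite in_itv/= => Xw k _; split => //=; rewrite in_itv/=.
    by apply: le_trans Xw _; rewrite lerDl invr_ge0.
  have [Ew _] := Fw 0%N I; split => //=; rewrite in_itv/= leNgt; apply/negP => sX.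
  have {}sX : 0 < X w - sup S by rewrite subr_gt0.
  have [_ /=] := Fw (Num.truncn (X w - sup S)^-1) I; rewrite in_itv/=.
  have : (Num.truncn (X w - sup S)^-1).+1%:R^-1 < X w - sup S.
    rewrite -[ltRHS]invrK ltf_pV2 ?posrE ?invr_gt0//.
    exact: truncnS_gt.
  move: (_%:R^-1) => q; lra.
exists (F (sup S)); split => //; first by move=> w [].
by apply/eqP; rewrite eq_le PF andbT FG.
Qed.

End atomless.

(** * Labels with the same law *)

Section labels.
Context d (Om : measurableType d) d' (Z : measurableType d') (R : realType).
Variables (P : probability Om R) (Q : probability Z R).

(** A label stands for a finite sequence of bits, the bit [c] being appended to
the label [a] by [a.*2 + c]; the joint law of a sequence of bits is thus the law
of a single integer. *)
Definition same_law (f : Om -> nat) (g : Z -> nat) := forall a : nat,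
  [/\ measurable (f @^-1` [set a]), measurable (g @^-1` [set a]) &
      P (f @^-1` [set a]) = Q (g @^-1` [set a])].

Lemma same_law_preimage f g (A : set nat) : same_law f g ->
  [/\ measurable (f @^-1` A), measurable (g @^-1` A) &
      P (f @^-1` A) = Q (g @^-1` A)].
Proof.
move=> fg.
have fE (T : Type) (h : T -> nat) :
    h @^-1` A = \bigcup_(a in A) (h @^-1` [set a]).
  by apply/seteqP; split => [w Aw|w [a Aa /= ->]//]; exists (h w).
have tr (T : Type) (h : T -> nat) : trivIset A (fun a => h @^-1` [set a]).
  by move=> a b _ _ [w [/= <- <-]].
rewrite !fE; split.
- by apply: bigcup_measurable => a _; have [] := fg a.
- by apply: bigcup_measurable => a _; have [] := fg a.
rewrite !measure_bigcup//; first by apply: eq_eseriesr => a _; have [] := fg a.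
- by move=> a _; have [] := fg a.
- by move=> a _; have [] := fg a.
Qed.

Lemma same_law_integral f g (h : nat -> R) : same_law f g ->
  (forall a, 0 <= h a) ->
  (\int[P]_w (h (f w))%:E = \int[Q]_z (h (g z))%:E)%E.
Proof.
move=> fg h0.
have mf : measurable_fun setT f.
  by move=> _ A _; rewrite setTI; have [] := same_law_preimage A fg.
have mg : measurable_fun setT g.
  by move=> _ A _; rewrite setTI; have [] := same_law_preimage A fg.
transitivity (\int[pushforward P f]_a (h a)%:E)%E.
  rewrite ge0_integral_pushforward//; last by move=> a _; rewrite lee_fin.
transitivity (\int[pushforward Q g]_a (h a)%:E)%E.
  apply: eq_measure_integral => A _ _.
  by have [] := same_law_preimage A fg.
rewrite ge0_integral_pushforward//; last by move=> a _; rewrite lee_fin.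
Qed.

(** A label carried by the second space can be refined by one more bit on the
first one, without changing the joint law, as soon as events of the first space
can be split in arbitrary proportions. *)
Hypothesis splitP : forall (E : set Om) (m : \bar R), measurable E ->
  (0 <= m <= P E)%E -> exists F, [/\ measurable F, F `<=` E & P F = m].

Lemma same_law_refine f g (b : Z -> bool) : same_law f g ->
  measurable_fun setT b ->
  exists e : Om -> bool,
    same_law (fun w => (f w).*2 + e w)%N (fun z => (g z).*2 + b z)%N.
Proof.
move=> fg mb.
have mB : measurable (b @^-1` [set true]).
  by rewrite -[X in measurable X]setTI; exact: mb.
have hF a : exists F, [/\ measurable F, F `<=` f @^-1` [set a] &
    P F = Q (g @^-1` [set a] `&` b @^-1` [set true])].
  have [mf mg fga] := fg a; apply: splitP => //.
  by rewrite measure_ge0/= fga le_measure// inE//; exact: measurableI.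
have [F FP] := choice hF.
have eF a w : f w = a -> `[< F (f w) w >] = `[< F a w >] by move=> ->.
exists (fun w => `[< F (f w) w >]) => c.
have [mf mg fgc] := fg c./2; have [mF Ff PF] := FP c./2.
have half_eq (x : nat) (y : bool) : (x.*2 + y)%N = c <-> x = c./2 /\ y = odd c.
  split=> [<-|[-> ->]].
    by rewrite addnC half_bit_double oddD odd_double addbF oddb.
  by rewrite addnC odd_double_half.
have -> : (fun z => (g z).*2 + b z)%N @^-1` [set c] =
    g @^-1` [set c./2] `&` b @^-1` [set odd c].
  by apply/seteqP; split => z /= /half_eq.
have -> : (fun w => (f w).*2 + `[< F (f w) w >])%N @^-1` [set c] =
    if odd c then F c./2 else f @^-1` [set c./2] `\` F c./2.
  apply/seteqP; split => w /=.
    move=> /half_eq[fw]; rewrite (eF _ _ fw) => <-.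
    by case: asboolP.
  move=> Fw; suff [fw ew] : f w = c./2 /\ `[< F c./2 w >] = odd c.
    by apply/half_eq; rewrite (eF _ _ fw).
  case: (odd c) Fw => [Fw|[fw nFw]]; first by split; [exact: Ff|exact/asboolP].
  by split => //; apply/asboolP.
case: (odd c); first by split => //; exact: measurableI.
have -> : g @^-1` [set c./2] `&` b @^-1` [set false] =
   g @^-1` [set c./2] `\` (g @^-1` [set c./2] `&` b @^-1` [set true]).
  apply/seteqP; split => z /= [gz].
    by move=> bz; split => // -[_]; rewrite bz.
  by case: (b z) => // h; exfalso; apply: h.
have mgB : measurable (g @^-1` [set c./2] `&` b @^-1` [set true]).
  exact: measurableI.
split; [exact: measurableD|exact: measurableD|].
have fin d0 (T : measurableType d0) (mu : probability T R) (A : set T) :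
    measurable A -> (mu A < +oo)%E.
  by move=> mA; exact: le_lt_trans (probability_le1 mu mA) (ltry _).
rewrite !measureD//; [|exact: fin|exact: fin].
by congr (_ - _)%E => //; rewrite setIA setIid (setIidr Ff); exact: PF.
Qed.

(** The successive bits are chosen as functions of the label reached so far, which
has the prescribed law by induction. *)
Lemma same_law_bits f0 g0 (b : nat -> Z -> bool) : same_law f0 g0 ->
  (forall i, measurable_fun setT (b i)) ->
  exists (e : nat -> Om -> bool) (f : nat -> Om -> nat) (g : nat -> Z -> nat),
  [/\ f 0%N = f0, g 0%N = g0,
      forall i w, f i.+1 w = ((f i w).*2 + e i w)%N,
      forall i z, g i.+1 z = ((g i z).*2 + b i z)%N &
      forall i, same_law (f i) (g i)].
Proof.
move=> fg0 mb.
pose g := fix g i := match i with 0%N => g0 |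
  j.+1 => fun z => ((g j z).*2 + b j z)%N end.
have hE (p : nat * (Om -> nat)) : exists e : Om -> bool,
   same_law p.2 (g p.1) -> same_law (fun w => (p.2 w).*2 + e w)%N (g p.1.+1).
  have [fg|nfg] := pselect (same_law p.2 (g p.1)); last by exists (fun=> true).
  by have [e he] := same_law_refine fg (mb p.1); exists e.
have [E EP] := choice hE.
pose f := fix f i := match i with 0%N => f0 |
  j.+1 => fun w => ((f j w).*2 + E (j, f j) w)%N end.
exists (fun i => E (i, f i)), f, g; split => //.
by elim=> [//|i IH]; have := EP (i, f i) IH.
Qed.

End labels.

(** The bit number [i] of a label obtained after [m] steps. *)
Definition bit_at (m i c : nat) : bool := odd (iter (m - i).-1 half c).

Lemma bit_atE (T : Type) (f : nat -> T -> nat) (e : nat -> T -> bool) :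
  (forall i w, f i.+1 w = ((f i w).*2 + e i w)%N) ->
  forall m i w, (i < m)%N -> bit_at m i (f m w) = e i w.
Proof.
move=> fE m i w; elim: m => // m IH; rewrite ltnS leq_eqVlt => /predU1P[->|im].
  by rewrite /bit_at subSnn /= fE oddD odd_double addFb oddb.
rewrite -IH// /bit_at subSn ?(ltnW im)// -(subnSK im) /= -iterS iterSr.
by rewrite fE addnC half_bit_double.
Qed.

Lemma iter_half_label (T : Type) (f : nat -> T -> nat) (e : nat -> T -> bool) :
  (forall i w, f i.+1 w = ((f i w).*2 + e i w)%N) ->
  forall m w, iter m half (f m w) = f 0%N w.
Proof.
move=> fE; elim=> // m IH w.
by rewrite iterSr fE addnC half_bit_double IH.
Qed.

(** * Binary digits *)

Section binary.
Variable R : realType.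
Implicit Types (x : R) (e : nat -> bool).

(** The greedy binary expansion of a point of the unit interval: [binary_rest x j]
is the remainder after [j] digits, multiplied by [2 ^ j]. *)
Fixpoint binary_rest x j : R := match j with
  | 0%N => x
  | i.+1 => 2 * binary_rest x i - ((2^-1 <= binary_rest x i :> R)%R : nat)%:R
  end.

Definition binary_digit x j : bool := 2^-1 <= binary_rest x j.

Definition binary_sum e J : R := \sum_(j < J) (e j : nat)%:R * 2^-1 ^+ j.+1.

Lemma binary_rest_itv x j : 0 <= x <= 1 -> 0 <= binary_rest x j <= 1.
Proof.
move=> x01; elim: j => //= j; set r := binary_rest x j.
have [r1|r1] := leP 2^-1 r => /andP[? ?]; rewrite /=; apply/andP; split; lra.
Qed.

Lemma binary_sum_digit x J :
  x = binary_sum (binary_digit x) J + 2^-1 ^+ J * binary_rest x J.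
Proof.
elim: J => [|J IH]; first by rewrite /binary_sum big_ord0 expr0 add0r mul1r.
rewrite {1}IH /binary_sum big_ord_recr /= -addrA; congr (_ + _).
rewrite -/(binary_digit x J) exprS; set d := _%:R; set r := binary_rest x J.
by field.
Qed.

Lemma binary_sum_digit_approx x J : 0 <= x <= 1 ->
  `|x - binary_sum (binary_digit x) J| <= 2^-1 ^+ J.
Proof.
move=> x01; rewrite {1}(binary_sum_digit x J) addrC addKr.
have /andP[r0 r1] := binary_rest_itv J x01.
by rewrite ger0_norm ?mulr_ge0// ler_piMr.
Qed.

Lemma binary_sum_tail e J K : (J <= K)%N ->
  binary_sum e J <= binary_sum e K <= binary_sum e J + 2^-1 ^+ J - 2^-1 ^+ K.
Proof.
move=> /subnK <-; elim: (K - J)%N => [|i]; first by rewrite add0n addrK lexx.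
have -> : binary_sum e (i.+1 + J) =
    binary_sum e (i + J) + (e (i + J)%N : nat)%:R * 2^-1 ^+ (i + J).+1.
  by rewrite addSn /binary_sum big_ord_recr.
rewrite addSn; set s := binary_sum e (i + J); rewrite exprS.
have : 0 <= 2^-1 ^+ (i + J) :> R by rewrite exprn_ge0.
set q := 2^-1 ^+ (i + J) => q0 /andP[h1 h2].
by case: (e _); apply/andP; split; rewrite /= ?mul1r ?mul0r; lra.
Qed.

Definition binary_value e : R := limn (binary_sum e).

Lemma binary_sum_cvg e : cvgn (binary_sum e).
Proof.
apply: nondecreasing_is_cvgn; first by move=> i j /(binary_sum_tail e)/andP[].
exists 1 => _ [J _ <-]; have /andP[_] := binary_sum_tail e (leq0n J).
rewrite {2}/binary_sum big_ord0 expr0 add0r => /le_trans; apply.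
by rewrite gerBl exprn_ge0.
Qed.

Lemma binary_value_approx e J : `|binary_value e - binary_sum e J| <= 2^-1 ^+ J.
Proof.
have h1 : binary_sum e J <= binary_value e.
  apply: limr_ge; first exact: binary_sum_cvg.
  by exists J => // K /= /(binary_sum_tail e)/andP[].
have h2 : binary_value e <= binary_sum e J + 2^-1 ^+ J.
  apply: limr_le; first exact: binary_sum_cvg.
  exists J => // K /= /(binary_sum_tail e)/andP[_] /le_trans; apply.
  by rewrite gerBl exprn_ge0.
by rewrite ger0_norm; lra.
Qed.

Lemma measurable_nat_of_bool d (T : measurableType d) (b : T -> bool) :
  measurable_fun setT b -> measurable_fun setT (fun t => (b t : nat)%:R : R).
Proof.
move=> mb; have -> : (fun t => (b t : nat)%:R : R) = (fun t => if b t then 1 else 0).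
  by apply/funext => t; case: (b t).
exact: measurable_fun_ifT.
Qed.

Lemma measurable_binary_sum d (T : measurableType d) (e : nat -> T -> bool) J :
  (forall j, measurable_fun setT (e j)) ->
  measurable_fun setT (fun t => binary_sum (fun j => e j t) J).
Proof.
move=> me; apply: measurable_sum => j; apply: measurable_funM => //.
exact: measurable_nat_of_bool.
Qed.

Lemma measurable_binary_value d (T : measurableType d) (e : nat -> T -> bool) :
  (forall j, measurable_fun setT (e j)) ->
  measurable_fun setT (fun t => binary_value (fun j => e j t)).
Proof.
move=> me.
apply: (measurable_fun_cvg (h := fun J t => binary_sum (fun j => e j t) J)).
  by move=> J; exact: measurable_binary_sum.
by move=> t _; exact: binary_sum_cvg.
Qed.

Lemma measurable_binary_digit d (T : measurableType d) (f : T -> R) j :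
  measurable_fun setT f -> measurable_fun setT (fun t => binary_digit (f t) j).
Proof.
move=> mf.
have mr : measurable_fun setT (fun t => binary_rest (f t) j).
  elim: j => [//|j IH] /=; apply: measurable_funB; first exact: measurable_funM.
  by apply: measurable_nat_of_bool; exact: measurable_fun_ler.
exact: measurable_fun_ler.
Qed.

End binary.

(** * Realising a random vector by a map *)

Section realize.
Context d (Om : measurableType d) d' (Z : measurableType d') (R : realType).
Variables (P : probability Om R) (Q : probability Z R).
Hypothesis splitP : forall (E : set Om) (m : \bar R), measurable E ->
  (0 <= m <= P E)%E -> exists F, [/\ measurable F, F `<=` E & P F = m].
Variables (n : nat) (l0 : 'I_n).
Implicit Types zeta : Z -> borelRn R n.

(** The coordinates of [zeta] are coded by their binary digits, the digits of
all coordinates being listed in one sequence: the digit number [j * n + l] is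
the [j]-th one of the coordinate [l]. Refining the labels by these digits one
after the other yields digits on the first space, hence a map [T]. *)
Lemma same_law_realize (L : R) (f0 : Om -> nat) (g0 : Z -> nat) zeta : 0 < L ->
  measurable_fun setT zeta ->
  (forall z l, `|(zeta z : 'rV[R]_n) ord0 l| <= L) ->
  same_law P Q f0 g0 ->
  exists T : Om -> borelRn R n, measurable_fun setT T /\
    forall eps, 0 < eps -> exists f g (Phi : nat -> 'rV[R]_n) (Psi : nat -> nat),
      [/\ same_law P Q f g, f0 = Psi \o f, g0 = Psi \o g,
          forall w l, `|(T w : 'rV[R]_n) ord0 l - Phi (f w) ord0 l| <= eps &
          forall z l, `|(zeta z : 'rV[R]_n) ord0 l - Phi (g z) ord0 l| <= eps].
Proof.
move=> L0 mz zL fg0.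
have n0 : (0 < n)%N by case: (n) l0 => // -[].
pose x z l := ((zeta z : 'rV[R]_n) ord0 l + L) / (2 * L).
have x01 z l : 0 <= x z l <= 1.
  have := zL z l; rewrite ler_norml => /andP[h1 h2].
  rewrite /x divr_ge0 ?mulr_ge0 ?(ltW L0)//=; last lra.
  by rewrite ler_pdivrMr ?mulr_gt0//; lra.
pose b i z := binary_digit (x z (insubd l0 (i %% n)%N)) (i %/ n)%N.
have mb i : measurable_fun setT (b i).
  apply: measurable_binary_digit; apply: measurable_funM => //.
  by apply: measurable_funD => //; exact: measurable_coord_comp.
have [e [f [g [f00 g00 fS gS fg]]]] := same_law_bits splitP fg0 mb.
have me i : measurable_fun setT (e i).
  have mbi (c : nat) : measurable (f i.+1 @^-1` [set a | odd a = odd c]).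
    by have [] := same_law_preimage [set a | odd a = odd c] (fg i.+1).
  apply: (@measurable_fun_bool _ _ _ _ true).
  rewrite setTI; have := mbi 1%N; congr measurable.
  by apply/seteqP; split => w /=; rewrite fS oddD odd_double addFb oddb.
pose dig (l : 'I_n) j := (j * n + l)%N.
have bdig l j z : b (dig l j) z = binary_digit (x z l) j.
  rewrite /b /dig modnMDl modn_small// divnMDl// divn_small// addn0.
  congr (binary_digit (x z _) _); apply/val_inj.
  by rewrite val_insubd ltn_ord.
pose T w : 'rV[R]_n := \row_l (2 * L * binary_value R (fun j => e (dig l j) w) - L).
exists T; split.
  apply: measurable_to_rV => l; rewrite /T.
  under eq_fun do rewrite mxE.
  apply: measurable_funB => //; apply: measurable_funM => //.
  by apply: (measurable_binary_value (e := fun j => e (dig l j))).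
move=> eps eps0.
pose J := (Num.truncn (2 * L / eps)).+1.
have JL : 2 * L * 2^-1 ^+ J <= eps.
  rewrite exprVn ler_pdivrMr ?exprn_gt0// [leRHS]mulrC -ler_pdivrMr//.
  apply: le_trans (ltW (truncnS_gt _)) _.
  by rewrite -natrX ler_nat ltnW// ltn_expl.
pose Phi c : 'rV[R]_n :=
  \row_l (2 * L * binary_sum R (fun j => bit_at (J * n) (dig l j) c) J - L).
have digJ l j : (j < J)%N -> (dig l j < J * n)%N.
  move=> jJ; rewrite /dig; apply: leq_trans (_ : j.+1 * n <= _)%N.
    by rewrite mulSn addnC ltn_add2r.
  by rewrite leq_mul2r jJ orbT.
have sumE (S : Type) (h : nat -> S -> nat) (c : nat -> S -> bool) s l :
    (forall i w, h i.+1 w = ((h i w).*2 + c i w)%N) ->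
    binary_sum R (fun j => bit_at (J * n) (dig l j) (h (J * n)%N s)) J =
    binary_sum R (fun j => c (dig l j) s) J.
  move=> hS; apply: eq_bigr => j _.
  by rewrite (bit_atE hS)// digJ.
exists (f (J * n)%N), (g (J * n)%N), Phi, (iter (J * n) half); split => //.
- by apply/funext => w /=; rewrite (iter_half_label fS) f00.
- by apply/funext => w /=; rewrite (iter_half_label gS) g00.
- move=> w l; rewrite /T /Phi !mxE (sumE _ _ _ _ _ fS).
  rewrite opprB addrA subrK -mulrBr normrM ger0_norm ?mulr_ge0 ?(ltW L0)//.
  apply: le_trans _ JL; rewrite ler_wpM2l ?mulr_ge0 ?(ltW L0)//.
  exact: binary_value_approx.
- move=> z l; rewrite /Phi !mxE (sumE _ _ _ _ _ gS).
  rewrite (_ : (zeta z : 'rV[R]_n) ord0 l = 2 * L * x z l - L); last first.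
    by rewrite /x mulrCA divff ?mulr1 ?addrK// mulf_neq0// gt_eqF.
  rewrite opprB addrA subrK -mulrBr normrM ger0_norm ?mulr_ge0 ?(ltW L0)//.
  apply: le_trans _ JL; rewrite ler_wpM2l ?mulr_ge0 ?(ltW L0)//.
  under [binary_sum R _ J]eq_bigr do rewrite bdig.
  exact: binary_sum_digit_approx.
Qed.

End realize.

(** * Equality of laws *)

Lemma pushforward_probability d (Om : measurableType d) d' (T2 : measurableType d')
    (R : realType) (P : probability Om R) (f : Om -> T2) :
  measurable_fun setT f ->
  exists mu : probability T2 R, forall A, mu A = P (f @^-1` A).
Proof.
move=> mf; pose X : {mfun Om >-> T2} := HB.pack f (isMeasurableFun.Build _ _ _ _ _ mf).
by exists (distribution P X).
Qed.

Section transport.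
Variables (R : realType) (n : nat).

Definition close_on (T : Type) (f g : T -> 'rV[R]_n) (eps : R) :=
  forall t l, `|f t ord0 l - g t ord0 l| <= eps.

Lemma closed_cap_nbhs (C : set 'rV[R]_n) : closed C ->
  \bigcap_k (\bigcup_(y in C) ball y (k.+1%:R^-1 : R)) = C.
Proof.
move=> cC; apply/seteqP; split => [x Cx|x Cx k _]; last first.
  by exists x => //; apply: ballxx.
apply: cC => B /nbhs_ballP[e /= e0 eB].
have [y Cy yx] := Cx (Num.truncn e^-1) I.
exists y; split => //; apply: eB; apply/ball_sym.
apply: le_ball yx; rewrite -[leRHS]invrK lef_pV2 ?posrE ?invr_gt0//.
exact/ltW/truncnS_gt.
Qed.

Section le_law.
Context d (Om : measurableType d) d' (Z : measurableType d').
Variables (P : probability Om R) (Q : probability Z R).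
Variables (T : Om -> borelRn R n) (zeta : Z -> borelRn R n).
Hypotheses (mT : measurable_fun setT T) (mz : measurable_fun setT zeta).
Hypothesis approx : forall eps, 0 < eps -> exists f g (Phi : nat -> 'rV[R]_n),
  [/\ same_law P Q f g, close_on T (Phi \o f) eps & close_on zeta (Phi \o g) eps].

(** A closed set [C] is the intersection of its neighbourhoods. If [T] is in [C]
then its approximate value, which depends on the label only, is close to [C]; the
labels having the same law, this event has the same probability for [zeta], and
implies that [zeta] is in a slightly larger neighbourhood of [C]. *)
Lemma le_law_closed (C : set 'rV[R]_n) : closed C ->
  (P (T @^-1` C) <= Q (zeta @^-1` C))%E.
Proof.
move=> cC.
pose N k : set 'rV[R]_n := \bigcup_(y in C) ball y (k.+1%:R^-1 : R).
have oN k : open (N k).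
  apply: bigcup_open => y _; apply: (@ball_open R 'rV[R]_n).
rewrite -[X in (_ <= Q (_ @^-1` X))%E](closed_cap_nbhs cC) preimage_bigcap.
apply: probability_bigcap_ge.
- move=> k; rewrite -[X in measurable X]setTI; apply: mz => //.
  exact: (measurable_open_rV (oN k)).
- move=> i j ij; apply/subsetPset; apply: preimage_subset => x [y Cy yx].
  by exists y => //; apply: le_ball yx; rewrite lef_pV2 ?posrE// ler_nat ltnS.
move=> k; have e0 : 0 < k.+1%:R^-1 / 3 :> R by rewrite divr_gt0 ?invr_gt0.
have [f [g [Phi [fg Tf zg]]]] := approx e0.
pose A : set nat := [set a | exists2 y, C y &
   forall l, `|y ord0 l - Phi a ord0 l| <= k.+1%:R^-1 / 3].
have [mA mA' PQ] := same_law_preimage A fg.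
apply: le_trans (_ : P (f @^-1` A) <= _)%E.
  apply: le_measure; rewrite ?inE//.
    rewrite -[X in measurable X]setTI; apply: mT => //.
    exact: measurable_closed_rV.
  by move=> w Cw; exists (T w) => // l; exact: Tf.
rewrite PQ; apply: le_measure; rewrite ?inE//.
  rewrite -[X in measurable X]setTI; apply: mz => //.
  exact: (measurable_open_rV (oN k)).
move=> z [y Cy yz]; exists y => //; split => [|i l]; first by rewrite invr_gt0.
rewrite ord1 -ball_normE /=.
have := zg z l; have := yz l; rewrite /= !ler_norml ltr_norml => /andP[h1 h2] /andP[h3 h4].
move: (k.+1%:R^-1) e0 h1 h2 h3 h4 => q e0 h1 h2 h3 h4.
by apply/andP; split; lra.
Qed.

End le_law.

Section eq_law.
Context d (Om : measurableType d) d' (Z : measurableType d').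
Variables (P : probability Om R) (Q : probability Z R).
Variables (T : Om -> borelRn R n) (zeta : Z -> borelRn R n).
Hypotheses (mT : measurable_fun setT T) (mz : measurable_fun setT zeta).
Hypothesis approx : forall eps, 0 < eps -> exists f g (Phi : nat -> 'rV[R]_n),
  [/\ same_law P Q f g, close_on T (Phi \o f) eps & close_on zeta (Phi \o g) eps].

(** The two inequalities on closed sets give equality on open sets, which
generate the Borel sets and are stable under intersection. *)
Lemma eq_law_of_approx (A : set (borelRn R n)) : measurable A ->
  P (T @^-1` A) = Q (zeta @^-1` A).
Proof.
have approx' eps : 0 < eps -> exists f g (Phi : nat -> 'rV[R]_n),
    [/\ same_law Q P f g, close_on zeta (Phi \o f) eps & close_on T (Phi \o g) eps].
  move=> /approx[f [g [Phi [fg h1 h2]]]]; exists g, f, Phi; split => // a.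
  by have [? ? ?] := fg a; split.
have [m1 m1E] := pushforward_probability P mT.
have [m2 m2E] := pushforward_probability Q mz.
move=> mA; rewrite -m1E -m2E.
apply: (@measure_unique _ R (borelRn R n) (@open 'rV[R]_n) (fun=> setT) _ _ _ _ m1 m2) => //.
- exact: openI.
- by move=> _; exact: openT.
- by rewrite bigcup_const.
- move=> U oU.
  have mU : measurable (U : set (borelRn R n)) by exact: measurable_open_rV.
  have mUC := measurableC mU.
  have UE (m : probability (borelRn R n) R) : m U = (1 - m (~` U))%E.
    by rewrite -[in LHS](setCK U) (probability_setC m).
  rewrite [LHS]UE [RHS]UE; congr (1 - _)%E; rewrite m1E m2E.
  apply/eqP; rewrite eq_le; apply/andP; split; apply: le_law_closed => //;
    exact: open_closedC.
- by move=> _; exact: le_lt_trans (probability_le1 m1 measurableT) (ltry _).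
Qed.

End eq_law.
End transport.

(** * Maps close to a coupling *)

Section full_events.
Context d (T : measurableType d) (R : realType) (P : probability T R).

Lemma full_setC_null (E : set T) : measurable E -> P E = 1%E -> P (~` E) = 0%E.
Proof. by move=> mE PE; rewrite (probability_setC P mE) PE subee. Qed.

Lemma full_ae (E : set T) (Pr : T -> Prop) : measurable E -> P E = 1%E ->
  (forall t, E t -> Pr t) -> {ae P, forall t, Pr t}.
Proof.
move=> mE PE h; exists (~` E); split; [exact: measurableC|exact: full_setC_null|].
by move=> t /= nPr Et; apply: nPr; exact: h.
Qed.

Lemma eq_probability_on (E A B : set T) : measurable E -> P E = 1%E ->
  measurable A -> measurable B -> (forall t, E t -> A t <-> B t) -> P A = P B.
Proof.
move=> mE PE mA mB AB.
have le C D : measurable C -> measurable D -> (forall t, E t -> C t -> D t) ->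
    (P C <= P D)%E.
  move=> mC mD CD; apply: le_trans (_ : P (D `|` ~` E) <= _)%E.
    apply: le_measure; rewrite ?inE//.
      by apply: measurableU => //; exact: measurableC.
    by move=> t Ct; have [Et|nE] := pselect (E t); [left; exact: CD|right].
  have mEC := measurableC mE.
  apply: le_trans (measureU2 P mD mEC) _.
  by rewrite [X in (_ + X)%E](full_setC_null mE PE) adde0.
apply/eqP; rewrite eq_le !le// => t Et; [exact: (AB t Et).2|exact: (AB t Et).1].
Qed.

Lemma integral_le_add_cst (E : set T) (f g : T -> R) (c : R) :
  measurable E -> P E = 1%E -> measurable_fun setT f -> measurable_fun setT g ->
  (forall t, 0 <= f t) -> (forall t, 0 <= g t) -> 0 <= c ->
  (forall t, E t -> f t <= g t + c) ->
  (\int[P]_t (f t)%:E <= \int[P]_t (g t)%:E + c%:E)%E.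
Proof.
move=> mE PE mf mg f0 g0 c0 fg.
have -> : (\int[P]_t (g t)%:E + c%:E = \int[P]_t ((g t)%:E + c%:E))%E.
  rewrite ge0_integralD//=.
  - by rewrite integral_cst// [X in (_ * X)%E](probability_setT P) mule1.
  - by move=> t _; rewrite lee_fin.
  - exact/measurable_EFinP.
apply: ae_ge0_le_integral => //.
- by move=> t _; rewrite lee_fin.
- exact/measurable_EFinP.
- by move=> t _; rewrite -EFinD lee_fin addr_ge0.
- apply/measurable_EFinP; exact: measurable_funD.
- by apply: (full_ae mE PE) => t Et _; rewrite -EFinD lee_fin; exact: fg.
Qed.

End full_events.

Section coupling_map.
Variables (R : realType) (n : nat) (l0 : 'I_n).

(** Rounding every coordinate down to a multiple of [eps] leaves countably many
values, which can be numbered. *)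
Lemma quantize (eps : R) : 0 < eps -> exists (q : borelRn R n -> nat) (D : nat -> 'rV[R]_n),
  (forall a, measurable (q @^-1` [set a])) /\
  close_on (id : borelRn R n -> 'rV[R]_n) (D \o q) eps.
Proof.
move=> e0.
pose v (x : 'rV[R]_n) : 'rV[int]_n := \row_l Num.floor (x ord0 l / eps).
pose q (x : borelRn R n) : nat := pickle (v x).
pose D (a : nat) : 'rV[R]_n :=
  \row_l (((odflt 0 (unpickle a : option 'rV[int]_n)) ord0 l)%:~R * eps).
exists q, D; split => [a|x l]; last first.
  rewrite /D /q /= pickleK /= !mxE.
  have := floor_itv (x ord0 l / eps) => /andP[h1 h2].
  rewrite intrD in h2.
  rewrite -{1}(divfK (lt0r_neq0 e0) (x ord0 l)) -mulrBl normrM (gtr0_norm e0).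
  rewrite ler_piMl ?(ltW e0)// ler_norml; apply/andP; split; lra.
have [h|h] := pselect (exists u : 'rV[int]_n, pickle u = a); last first.
  rewrite (_ : q @^-1` _ = set0)//; apply/seteqP; split => // x /= qx.
  by apply: h; exists (v x).
have {h}[u <-] := h.
rewrite (_ : q @^-1` _ = \bigcap_(l in [set: 'I_n])
  ((fun x : borelRn R n => (x : 'rV[R]_n) ord0 l) @^-1`
     `[(u ord0 l)%:~R * eps, (u ord0 l + 1)%:~R * eps[)).
  apply: fin_bigcap_measurable => // l _.
  by rewrite -[X in measurable X]setTI; apply: measurable_coord.
apply/seteqP; split => [x /= /(pcan_inj pickleK) vu l _|x /= xu].
  rewrite /= in_itv/= -vu mxE; have := floor_itv (x ord0 l / eps).
  by rewrite ler_pdivlMr// ltr_pdivrMr.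
congr pickle; apply/rowP => l; rewrite mxE; apply/floor_def.
by have := xu l I; rewrite /= in_itv/= ler_pdivlMr// ltr_pdivrMr.
Qed.

Lemma measurable_in_bool d (T : measurableType d) (f : T -> borelRn R n)
    (Y : set 'rV[R]_n) : measurable_fun setT f ->
  measurable (Y : set (borelRn R n)) -> measurable_fun setT (fun t => `[< Y (f t) >]).
Proof.
move=> mf mY; apply: (@measurable_fun_bool _ _ _ _ true).
rewrite (_ : (fun _ => _) @^-1` _ = f @^-1` Y); first exact: mf.
by apply/seteqP; split => t /= /asboolP.
Qed.

Context d (Om : measurableType d) (P : probability Om R).
Hypothesis splitP : forall (E : set Om) (m : \bar R), measurable E ->
  (0 <= m <= P E)%E -> exists F, [/\ measurable F, F `<=` E & P F = m].

(** Couplings are realised by maps of an atomless space up to an arbitrarily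
small error: the second marginal is coded by bits refining an approximate value
of the first one, so the joint law is that of the coupling up to the precision
of that approximate value, whereas the second law is exact. *)
Lemma coupling_map (Y : set 'rV[R]_n) (S : Om -> borelRn R n)
    (pi : probability (borelRn R n * borelRn R n)%type R) (delta : R) :
  compact Y -> measurable_fun setT S ->
  (forall A, measurable A -> P (S @^-1` A) = pi (fst @^-1` A)) ->
  pi (snd @^-1` Y) = 1%E -> 0 < delta ->
  exists T : Om -> borelRn R n, [/\ measurable_fun setT T,
    forall w, Y (T w),
    forall A, measurable A -> P (T @^-1` A) = pi (snd @^-1` A) &
    (\int[P]_w (eucl_dist (S w) (T w))%:E <=
     \int[pi]_z (eucl_dist z.1 z.2)%:E + delta%:E)%E].
Proof.
move=> cY mS S1 piY d0.
have mY : measurable (Y : set (borelRn R n)) := measurable_compact_rV cY.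
have mY2 : measurable (snd @^-1` Y : set (borelRn R n * borelRn R n)).
  by rewrite -[X in measurable X]setTI; apply: measurable_snd.
have [y0 Yy0] : Y !=set0.
  apply/set0P; apply: contra_eqN piY => /eqP ->.
  by rewrite preimage_set0 measure0 eq_sym onee_eq0.
have [L L0 YL] : exists2 L : R, 0 < L & forall y, Y y -> forall l, `|y ord0 l| <= L.
  have [M [_ /(_ (M + 1))]] := compact_bounded cY.
  rewrite ltrDl ltr01 => /(_ isT) hM.
  exists (`|M| + 1); first by rewrite ltr_wpDl.
  move=> y Yy l; apply: le_trans (_ : `|y| <= _); last first.
    by apply: le_trans (hM y Yy) _; rewrite lerD2r ler_norm.
  rewrite [leRHS]/Num.norm /= mx_normrE; apply/bigmax_geP; right => /=.
  by exists (ord0, l).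
have n0 : 0 < n%:R :> R by rewrite ltr0n; case: (n) l0 => // -[].
(* The second coordinate, modified on a null set so as to be bounded. *)
pose zeta (z : borelRn R n * borelRn R n) : borelRn R n :=
  if `[< Y z.2 >] then z.2 else y0.
have mzeta : measurable_fun setT zeta.
  by apply: measurable_fun_ifT => //; apply: measurable_in_bool.
have zetaY z : Y (zeta z) by rewrite /zeta; case: asboolP.
pose eps := delta / (4 * n%:R).
have eps0 : 0 < eps by rewrite divr_gt0// mulr_gt0.
have [q [D [mq Dq]]] := quantize eps0.
have mfst : measurable_fun setT (fst : borelRn R n * borelRn R n -> borelRn R n).
  exact: measurable_fst.
have fg0 : same_law P pi (q \o S) (q \o fst).
  move=> a; split; [| |exact: (S1 _ (mq a))].
    by rewrite -[X in measurable X]setTI; exact: (mS measurableT _ (mq a)).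
  by rewrite -[X in measurable X]setTI; exact: (mfst measurableT _ (mq a)).
have [T0 [mT0 approx]] := same_law_realize splitP l0 L0 mzeta (fun z => YL _ (zetaY z)) fg0.
have law0 A : measurable A -> P (T0 @^-1` A) = pi (snd @^-1` A).
  move=> mA; transitivity (pi (zeta @^-1` A)).
    apply: (eq_law_of_approx mT0 mzeta _ mA) => e /approx.
    move=> [f [g [Phi [Psi [fg _ _ h1 h2]]]]].
    by exists f, g, Phi; split.
  apply: (eq_probability_on mY2 piY).
  - by rewrite -[X in measurable X]setTI; exact: mzeta.
  - by rewrite -[X in measurable X]setTI; exact: measurable_snd.
  - by move=> z /= Yz; rewrite /zeta asboolT.
have PTY : P (T0 @^-1` Y) = 1%E by rewrite law0.
have mTY : measurable (T0 @^-1` Y).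
  by rewrite -[X in measurable X]setTI; exact: mT0.
pose T w : borelRn R n := if `[< Y (T0 w) >] then T0 w else y0.
have mT : measurable_fun setT T.
  by apply: measurable_fun_ifT => //; exact: measurable_in_bool.
exists T; split => //.
- by move=> w; rewrite /T; case: asboolP.
- move=> A mA; rewrite -law0//; apply: (eq_probability_on mTY PTY).
  + by rewrite -[X in measurable X]setTI; exact: mT.
  + by rewrite -[X in measurable X]setTI; exact: mT0.
  + by move=> w /= Yw; rewrite /T asboolT.
have [f [g [Phi [Psi [fg f0E g0E Tf zg]]]]] := approx _ eps0.
pose h a := eucl_dist (D (Psi a)) (Phi a).
have near (x y : 'rV[R]_n) a : (forall l, `|x ord0 l - D (Psi a) ord0 l| <= eps) ->
    (forall l, `|y ord0 l - Phi a ord0 l| <= eps) ->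
    eucl_dist x y <= h a + delta / 2 /\ h a <= eucl_dist x y + delta / 2.
  move=> /(eucl_dist_le_coord (ltW eps0)) h1 /(eucl_dist_le_coord (ltW eps0)) h2.
  have e2 : n%:R * eps = delta / 4.
    by rewrite /eps; field; rewrite gt_eqF.
  rewrite e2 in h1 h2.
  have t1 := eucl_dist_triangle x (D (Psi a)) y.
  have t2 := eucl_dist_triangle (D (Psi a)) (Phi a) y.
  have t3 := eucl_dist_triangle (D (Psi a)) x (Phi a).
  have t4 := eucl_dist_triangle x y (Phi a).
  rewrite (eucl_distC (Phi a) y) in t2; rewrite (eucl_distC _ x) in t3.
  by rewrite /h; split; [clear t3 t4|clear t1 t2]; lra.
have mhf : measurable_fun setT (fun w => h (f w)).
  by move=> _ A _; rewrite setTI; have [] := same_law_preimage (h @^-1` A) fg.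
have mhg : measurable_fun setT (fun z => h (g z)).
  by move=> _ A _; rewrite setTI; have [] := same_law_preimage (h @^-1` A) fg.
apply: le_trans (_ : \int[P]_w (h (f w))%:E + (delta / 2)%:E <= _)%E.
  apply: (integral_le_add_cst mTY PTY) => //.
  - exact: measurable_eucl_dist.
  - by move=> w; exact: eucl_dist_ge0.
  - by move=> w; exact: eucl_dist_ge0.
  - by rewrite divr_ge0// ltW.
  - move=> w /= Yw; apply: (near (S w) (T w) (f w) _ _).1 => l.
      by have := Dq (S w) l; rewrite /= -[q (S w)]/((q \o S) w) f0E.
    by rewrite /T asboolT.
have dE : delta = delta / 2 + delta / 2 by field.
rewrite [in leRHS]dE EFinD addeA; apply: leeD2r; rewrite (same_law_integral fg)//; last first.
  by move=> a; exact: eucl_dist_ge0.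
apply: (integral_le_add_cst mY2 piY) => //.
- exact: measurable_eucl_dist.
- by move=> w; exact: eucl_dist_ge0.
- by move=> w; exact: eucl_dist_ge0.
- by rewrite divr_ge0// ltW.
- move=> z /= Yz; apply: (near z.1 z.2 (g z) _ _).2 => l.
    by have := Dq z.1 l; rewrite /= -[q z.1]/((q \o fst) z) g0E.
  by have := zg z l; rewrite /zeta asboolT.
Qed.

End coupling_map.

(** * Diameters, graphs and averages *)

Lemma integral_law d (Om : measurableType d) d' (T2 : measurableType d')
    (R : realType) (P : probability Om R) (mu : probability T2 R) (f : Om -> T2)
    (h : T2 -> R) :
  measurable_fun setT f -> (forall A, measurable A -> mu A = P (f @^-1` A)) ->
  measurable_fun setT h -> (forall y, 0 <= h y) ->
  (\int[mu]_y (h y)%:E = \int[P]_w (h (f w))%:E)%E.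
Proof.
move=> mf muE mh h0.
transitivity (\int[pushforward P f]_y (h y)%:E)%E.
  by apply: eq_measure_integral => A mA _; exact: muE.
rewrite ge0_integral_pushforward//; first exact/measurable_EFinP.
by move=> y _; rewrite lee_fin.
Qed.

Lemma integral_on_full d (T : measurableType d) (R : realType) (P : probability T R)
    (E : set T) (f : T -> R) : measurable E -> P E = 1%E ->
  measurable_fun setT f -> (forall t, 0 <= f t) ->
  (\int[P]_(t in E) (f t)%:E = \int[P]_t (f t)%:E)%E.
Proof.
move=> mE PE mf f0; rewrite [RHS](@ge0_negligible_integral _ _ _ _ setT (~` E)) //.
- by rewrite setTD setCK.
- exact: measurableC.
- exact/measurable_EFinP.
- by move=> t _; rewrite lee_fin.
- exact: full_setC_null.
Qed.

Section diameter.
Variables (R : realType) (n : nat).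

Lemma compact_eucl_bounded (A : set 'rV[R]_n) : compact A ->
  exists M, forall x y, A x -> A y -> eucl_dist x y <= M.
Proof.
move=> cA; have [M [_ /(_ (M + 1))]] := compact_bounded cA.
rewrite ltrDl ltr01 => /(_ isT) hM.
exists (n%:R * (`|M| + 1 + (`|M| + 1))) => x y Ax Ay.
have coord z l : A z -> `|z ord0 l| <= `|M| + 1.
  move=> Az; apply: le_trans (_ : `|z| <= _); last first.
    by apply: le_trans (hM z Az) _; rewrite lerD2r ler_norm.
  rewrite [leRHS]/Num.norm /= mx_normrE; apply/bigmax_geP; right => /=.
  by exists (ord0, l).
apply: eucl_dist_le_coord => [|l]; first by rewrite !addr_ge0.
by apply: le_trans (ler_normB _ _) _; rewrite lerD// coord.
Qed.

Lemma eucl_dist_le_diam (A : set 'rV[R]_n) x y : compact A -> A x -> A y ->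
  eucl_dist x y <= eucl_diam A.
Proof.
move=> /compact_eucl_bounded[M hM] Ax Ay; apply: ub_le_sup; last by exists (x, y).
by exists M => _ [[a b] [/= Aa Ab] <-]; exact: hM.
Qed.

End diameter.

Section graph.
Variables (R : realType) (k n : nat).
Implicit Types T : 'I_k -> borelRn R n -> borelRn R n.

Lemma graph_point0 T x : graph_point T x ord0 = x.
Proof. by rewrite /graph_point unlift_none. Qed.

Lemma graph_pointS T x i : graph_point T x (lift ord0 i) = T i x.
Proof. by rewrite /graph_point liftK. Qed.

Lemma measurable_graph_point T i : (forall j, measurable_fun setT (T j)) ->
  measurable_fun setT ((fun x => graph_point T x i) : borelRn R n -> borelRn R n).
Proof. by move=> mT; rewrite /graph_point; case: unlift => [j|]. Qed.

Lemma measurable_bary_cost lam T : \sum_i lam i = 1 ->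
  (forall j, measurable_fun setT (T j)) ->
  measurable_fun setT (fun x => bary_cost lam (graph_point T x)).
Proof.
move=> lam1 mT; under eq_fun do rewrite (bary_costE _ 0 lam1).
have msub i : measurable_fun setT
    ((fun x => graph_point T x i - 0) : borelRn R n -> borelRn R n).
  apply: (measurable_subv (g := fun=> 0)) => //; exact: measurable_graph_point.
apply: measurable_funB; apply: measurable_funM => //.
  by apply: measurable_sum => i; apply: measurable_funM => //; apply: measurable_esq.
by apply: measurable_esq; apply: measurable_sumv => i; exact: measurable_scalev.
Qed.

Lemma bary_cost_ge0 (lam : 'I_k.+1 -> R) (x : 'I_k.+1 -> 'rV[R]_n) : (forall i, 0 < lam i) ->
  0 <= bary_cost lam x.
Proof.
move=> lam0; apply: lb_le_inf.
  by exists (\sum_i lam i / 2 * eucl_dist (x i) 0 ^+ 2); exists 0.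
move=> _ [y _ <-]; apply: sumr_ge0 => i _.
by rewrite mulr_ge0 ?sqr_ge0// divr_ge0// ltW.
Qed.

End graph.

Section averages.
Variables (R : realType) (k n : nat) (lam : 'I_k.+1 -> R).
Hypotheses (lam0 : forall i, 0 < lam i) (lam1 : \sum_i lam i = 1).

Lemma weight_le1 i : lam i <= 1.
Proof.
by rewrite -lam1 (bigD1 i)//= lerDl; apply: sumr_ge0 => j _; exact: ltW.
Qed.

Lemma sum_esq_le (v : 'I_k.+1 -> 'rV[R]_n) M : (forall i, esq (v i) <= M) ->
  \sum_i lam i * esq (v i) <= M.
Proof.
move=> vM; rewrite -[leRHS]mul1r -lam1 mulr_suml; apply: ler_sum => i _.
by rewrite ler_wpM2l// ltW.
Qed.

(** Convexity of the square: twice the barycentric cost is the weighted variance,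
which is nonnegative. *)
Lemma esq_sum_le (v : 'I_k.+1 -> 'rV[R]_n) M : (forall i, esq (v i) <= M) ->
  esq (\sum_i lam i *: v i) <= M.
Proof.
move=> vM; apply: le_trans (sum_esq_le vM).
have := bary_cost_ge0 v lam0; rewrite (bary_costE v 0 lam1).
under eq_bigr do rewrite subr0.
under [X in esq X]eq_bigr do rewrite subr0.
lra.
Qed.

End averages.

(** * Optimality against one competitor map *)

Section stability.
Variables (R : realType) (k n : nat) (l0 : 'I_n) (lam : 'I_k.+1 -> R)
    (S Y : set 'rV[R]_n) (rho : probability (borelRn R n) R)
    (mu : 'I_k -> probability (borelRn R n) R)
    (T : 'I_k -> borelRn R n -> borelRn R n).
Hypothesis hyp : mm_setting lam S Y rho mu T.

Let D := eucl_diam (S `|` Y) + 1.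
Let w i := lam (lift ord0 i).

Let lam0 := weights_gt0 hyp.
Let lam1 := weights_sum1 hyp.

Let mS : measurable (S : set (borelRn R n)).
Proof. exact: measurable_compact_rV (source_compact hyp). Qed.

Let mY : measurable (Y : set (borelRn R n)).
Proof. exact: measurable_compact_rV (target_compact hyp). Qed.

Let trT : transport_maps S Y rho mu T := (maps_optimal hyp).1.

Let cSY : compact (S `|` Y).
Proof. exact: compactU (source_compact hyp) (target_compact hyp). Qed.

Lemma stability_dist_le x y : (S `|` Y) x -> (S `|` Y) y -> eucl_dist x y <= D.
Proof.
move=> Sx Sy; apply: le_trans (eucl_dist_le_diam cSY Sx Sy) _.
by rewrite /D lerDl.
Qed.

Lemma stability_esq_le x y : (S `|` Y) x -> (S `|` Y) y -> esq (x - y) <= D ^+ 2.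
Proof.
move=> Sx Sy; rewrite -sqr_eucl_dist ler_sqr ?nnegrE ?eucl_dist_ge0//.
  exact: stability_dist_le.
exact: le_trans (eucl_dist_ge0 x y) (stability_dist_le Sx Sy).
Qed.

Lemma diam_pos : 0 < D.
Proof.
have [x Sx] : S !=set0.
  apply/set0P; apply: contra_eqN (rho_on_source hyp) => /eqP ->.
  by rewrite measure0 eq_sym onee_eq0.
have Sx' : (S `|` Y) x by left.
have := eucl_dist_le_diam cSY Sx' Sx'; rewrite eucl_dist_refl /D; lra.
Qed.

Lemma bounded_integrable (f : borelRn R n -> R) M : measurable_fun [set: _] f ->
  (forall x, S x -> `|f x| <= M) -> rho.-integrable S (EFin \o f).
Proof.
move=> mf fM; apply: measurable_bounded_integrable => //.
- by rewrite [X in (X < _)%E](rho_on_source hyp) ltry.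
- exact: measurable_funTS.
- exists M; split; first exact: num_real.
  by move=> M' MM' x Sx; exact: le_trans (fM x Sx) (ltW MM').
Qed.

Lemma graph_pointSY T' x i : transport_maps S Y rho mu T' -> S x ->
  (S `|` Y) (graph_point T' x i).
Proof.
move=> tr Sx; rewrite /graph_point; case: unlift => [j|]; last by left.
by right; exact: (transport_range tr).
Qed.

Lemma bary_cost_le T' x : transport_maps S Y rho mu T' -> S x ->
  `|bary_cost lam (graph_point T' x)| <= D ^+ 2.
Proof.
move=> tr Sx; rewrite ger0_norm; last exact: bary_cost_ge0.
rewrite (bary_costE _ x lam1).
apply: le_trans (_ : D ^+ 2 - 0 <= _); last by rewrite subr0.
apply: lerB; last by rewrite mulr_ge0 ?esq_ge0 ?invr_ge0.
apply: le_trans (_ : 2^-1 * D ^+ 2 <= _); last first.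
  by rewrite ler_piMl ?sqr_ge0// invf_le1// ler1n.
rewrite ler_wpM2l ?invr_ge0//; apply: sum_esq_le => // i.
by apply: stability_esq_le; [exact: graph_pointSY|left].
Qed.

Lemma bary_cost_integrable T' : transport_maps S Y rho mu T' ->
  rho.-integrable S (fun x => (bary_cost lam (graph_point T' x))%:E).
Proof.
move=> tr; apply: (@bounded_integrable _ (D ^+ 2)) => [|x Sx].
  exact: measurable_bary_cost lam1 (transport_measurable tr).
exact: bary_cost_le.
Qed.

(** The barycenter relative to [y0], since the weights have sum 1. *)
Definition bary_dev y0 x : 'rV[R]_n := \sum_i lam i *: (graph_point T x i - y0).

Definition replace_map i (Ti : borelRn R n -> borelRn R n) j :=
  if j == i then Ti else T j.

Lemma integral_same_marginal i (Ti : borelRn R n -> borelRn R n) (h : borelRn R n -> R) :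
  measurable_fun [set: _] Ti ->
  (forall A, measurable A -> rho (Ti @^-1` A) = mu i A) ->
  measurable_fun [set: _] h -> (forall y, 0 <= h y) ->
  \int[rho]_(x in S) h (Ti x) = \int[rho]_(x in S) h (T i x).
Proof.
move=> mTi lawTi mh h0; congr fine.
have mTi' := transport_measurable trT i.
rewrite !(integral_on_full mS (rho_on_source hyp))//;
  try exact: measurableT_comp.
rewrite -(@integral_law _ _ _ _ _ _ (mu i))//; last by move=> A /lawTi.
rewrite -(@integral_law _ _ _ _ _ _ (mu i))// => A mA.
by rewrite -(transport_pushforward trT).
Qed.

(** Optimality tested against a competitor changing one map only: the part of
the cost depending on each marginal alone is unchanged, so the barycenter can
only be less spread. *)
Lemma optimal_perturbation i (Ti : borelRn R n -> borelRn R n) y0 : (S `|` Y) y0 ->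
  measurable_fun [set: _] Ti -> (forall x, Y (Ti x)) ->
  (forall A, measurable A -> rho (Ti @^-1` A) = mu i A) ->
  \int[rho]_(x in S) (2 * edot (bary_dev y0 x) ((Ti x : 'rV[R]_n) - T i x)
      + w i * esq ((Ti x : 'rV[R]_n) - T i x)) <= 0.
Proof.
move=> Yy0 mTi YTi lawTi.
have mT := transport_measurable trT.
pose T' := replace_map i Ti.
have trT' : transport_maps S Y rho mu T'.
  split=> [j|j x Sx|j A mA]; rewrite /T' /replace_map; case: eqVneq => [ji|_] //.
  - exact: (transport_range trT).
  - by rewrite ji -lawTi.
  - exact: (transport_pushforward trT).
have := (maps_optimal hyp).2 _ trT'.
have I1 := bary_cost_integrable trT.
have I2 := bary_cost_integrable trT'.
rewrite /mm_cost => le_cost.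
have {le_cost} : 0 <= \int[rho]_(x in S) (bary_cost lam (graph_point T' x)
     - bary_cost lam (graph_point T x)).
  rewrite (RintegralB mS I2 I1) subr_ge0 fine_le//; exact: integrable_fin_num.
pose a x := esq ((T i x : 'rV[R]_n) - y0).
pose a' x := esq ((Ti x : 'rV[R]_n) - y0).
pose q x := 2 * edot (bary_dev y0 x) ((Ti x : 'rV[R]_n) - T i x)
      + w i * esq ((Ti x : 'rV[R]_n) - T i x).
have costE x : bary_cost lam (graph_point T' x) - bary_cost lam (graph_point T x) =
    w i / 2 * (a' x - a x - q x).
  rewrite !(bary_costE _ y0 lam1) -/(bary_dev y0 x).
  have E (V : zmodType) (h : 'rV[R]_n -> V) (c : 'I_k.+1 -> V -> V) :
     \sum_j c j (h (graph_point T' x j)) = \sum_j c j (h (graph_point T x j))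
       - c (lift ord0 i) (h (T i x)) + c (lift ord0 i) (h (Ti x)).
    rewrite (bigD1 (lift ord0 i))//= [in RHS](bigD1 (lift ord0 i))//= !graph_pointS.
    rewrite [T' i]/T' /replace_map eqxx [RHS]addrC; congr (_ + _).
    rewrite [RHS]addrC addKr; apply: eq_bigr => j ji; congr (c j (h _)).
    rewrite /graph_point; case: unliftP => [j' jE|//].
    rewrite /T' /replace_map; case: eqVneq => // j'i.
    by rewrite jE j'i eqxx in ji.
  have -> : \sum_j lam j * esq (graph_point T' x j - y0) =
     \sum_j lam j * esq (graph_point T x j - y0) - w i * a x + w i * a' x.
    exact: (E _ (fun z => esq (z - y0)) (fun j z => lam j * z)).
  have -> : \sum_j lam j *: (graph_point T' x j - y0) =
     bary_dev y0 x + w i *: ((Ti x : 'rV[R]_n) - T i x).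
    rewrite (E _ (fun z => z - y0) (fun j z => lam j *: z)) /bary_dev -addrA.
    congr (_ + _); rewrite [LHS]addrC -scalerBr; congr (_ *: _).
    by rewrite opprB addrA subrK.
  rewrite /q; move: (bary_dev y0 x) ((Ti x : 'rV[R]_n) - T i x) => u v.
  rewrite [esq (u + _)]/esq !edotE (edotC v u) -!/(esq _); by field.
have SYT x : S x -> (S `|` Y) (T i x) by move=> Sx; right; exact: (transport_range trT).
have SYTi x : (S `|` Y) (Ti x) by right.
have ma : measurable_fun [set: borelRn R n] a.
  by apply: measurable_esq; apply: (measurable_subv (g := fun=> y0)).
have ma' : measurable_fun [set: borelRn R n] a'.
  by apply: measurable_esq; apply: (measurable_subv (g := fun=> y0)).
have Ia : rho.-integrable S (EFin \o a).
  apply: (@bounded_integrable _ (D ^+ 2)) => // x Sx.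
  by rewrite ger0_norm ?esq_ge0//; apply: stability_esq_le => //; exact: SYT.
have Ia' : rho.-integrable S (EFin \o a').
  apply: (@bounded_integrable _ (D ^+ 2)) => // x Sx.
  by rewrite ger0_norm ?esq_ge0//; apply: stability_esq_le.
have w0 : 0 < w i by exact: lam0.
pose c x := bary_cost lam (graph_point T' x) - bary_cost lam (graph_point T x).
have Ic : rho.-integrable S (EFin \o c).
  by have := integrableB mS I2 I1; apply: eq_integrable.
have qE x : q x = (a' x - a x) - 2 / w i * c x.
  by rewrite /c costE; field; rewrite gt_eqF.
move=> c0; rewrite -[X in X <= _]/(\int[rho]_(x in S) q x).
have -> : \int[rho]_(x in S) q x =
    \int[rho]_(x in S) ((a' x - a x) - 2 / w i * c x).
  by apply: eq_Rintegral => x _; exact: qE.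
have IB : rho.-integrable S (EFin \o (fun x => a' x - a x)).
  by have := integrableB mS Ia' Ia; apply: eq_integrable.
have IZ : rho.-integrable S (EFin \o (fun x => 2 / w i * c x)).
  by have := integrableZl mS (2 / w i) Ic; apply: eq_integrable.
rewrite (RintegralB mS IB IZ) (RintegralB mS Ia' Ia) (RintegralZl (2 / w i) mS Ic).
rewrite [X in X - _ - _](_ : _ = \int[rho]_(x in S) a x).
  by rewrite subrr sub0r oppr_le0 mulr_ge0// divr_ge0// ltW.
apply: (integral_same_marginal (h := fun y => esq ((y : 'rV[R]_n) - y0))) => //.
  by apply: measurable_esq; apply: (measurable_subv (g := fun=> y0)).
by move=> y; exact: esq_ge0.
Qed.

End stability.

(** * The energy estimate for two targets *)

Section pair.
Variables (R : realType) (k n : nat) (l0 : 'I_n) (lam : 'I_k.+1 -> R)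
    (S Y : set 'rV[R]_n) (rho : probability (borelRn R n) R)
    (mu : 'I_k -> probability (borelRn R n) R)
    (T : 'I_k -> borelRn R n -> borelRn R n).
Hypothesis hyp : mm_setting lam S Y rho mu T.

Let D := eucl_diam (S `|` Y) + 1.
Let w i := lam (lift ord0 i).

Lemma competitor_near (i j : 'I_k)
    (pi : probability (borelRn R n * borelRn R n)%type R) (delta : R) :
  (forall A, measurable A -> pi (fst @^-1` A) = mu i A) ->
  (forall A, measurable A -> pi (snd @^-1` A) = mu j A) -> 0 < delta ->
  exists Tj : borelRn R n -> borelRn R n, [/\ measurable_fun [set: _] Tj,
    forall x, Y (Tj x), forall A, measurable A -> rho (Tj @^-1` A) = mu j A &
    (\int[rho]_x (eucl_dist (T i x) (Tj x))%:E <=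
     \int[pi]_z (eucl_dist z.1 z.2)%:E + delta%:E)%E].
Proof.
move=> pi1 pi2 d0; have [trT _] := maps_optimal hyp.
have mY := measurable_compact_rV (target_compact hyp).
have splitP := atomless_split (measurable_coord l0)
  (fun t => hyperplane_null l0 t (rho_abs_continuous hyp)).
have lawi A : measurable A -> rho (T i @^-1` A) = pi (fst @^-1` A).
  by move=> mA; rewrite pi1// -(transport_pushforward trT i mA).
have piY : pi (snd @^-1` Y) = 1%E by rewrite pi2//; exact: (mu_on_target hyp).
have [Tj [mTj YTj lawTj dTj]] := coupling_map l0 splitP (target_compact hyp)
  (transport_measurable trT i) lawi piY d0.
by exists Tj; split => // A mA; rewrite lawTj// pi2.
Qed.

(** Both maps are tested against competitors: [Ti] of law [mu i] close to [T j],
and [Tj] of law [mu j] close to [T i]. The linear terms of the two optimality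
inequalities cancel up to the distances, while the quadratic ones add up to
twice the squared distance of [T i] and [T j]. *)
Lemma pair_energy_le (i j : 'I_k)
    (pi : probability (borelRn R n * borelRn R n)%type R) :
  w i = w j -> coupling (mu i) (mu j) pi ->
  ((w i)%:E * \int[rho]_x (esq ((T i x : 'rV[R]_n) - T j x))%:E <=
   (4 * D)%:E * \int[pi]_z (eucl_dist z.1 z.2)%:E)%E.
Proof.
move=> wij cpi; have [trT _] := maps_optimal hyp.
have mS : measurable (S : set (borelRn R n)) := measurable_compact_rV (source_compact hyp).
have mT := transport_measurable trT.
have D0 : 0 < D := diam_pos hyp.
have lam0 := weights_gt0 hyp; have lam1 := weights_sum1 hyp.
have [y0 Yy0] : Y !=set0.
  apply/set0P; apply: contra_eqN (mu_on_target hyp i) => /eqP ->.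
  by rewrite measure0 eq_sym onee_eq0.
have SYy0 : (S `|` Y) y0 by right.
set I := (\int[pi]_z _)%E.
have I0 : (0 <= I)%E by apply: integral_ge0 => z _; rewrite lee_fin eucl_dist_ge0.
have [->|Ifin] := eqVneq I +oo%E.
  by rewrite gt0_muley ?leey// lte_fin mulr_gt0.
have {Ifin}Ifin : I \is a fin_num by rewrite ge0_fin_numE// lt_neqAle Ifin leey.
pose swap (z : borelRn R n * borelRn R n) := (z.2, z.1).
have mswap : measurable_fun [set: _] swap.
  by apply: measurable_fun_pair; [exact: measurable_snd|exact: measurable_fst].
have [pi' pi'E] := pushforward_probability pi mswap.
have pi1 A : measurable A -> pi (fst @^-1` A) = mu i A by move=> /cpi[].
have pi2 A : measurable A -> pi (snd @^-1` A) = mu j A by move=> /cpi[].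
have pi1' A : measurable A -> pi' (fst @^-1` A) = mu j A by move=> /pi2 <-; rewrite pi'E.
have pi2' A : measurable A -> pi' (snd @^-1` A) = mu i A by move=> /pi1 <-; rewrite pi'E.
have I'E : (\int[pi']_z (eucl_dist z.1 z.2)%:E = I)%E.
  rewrite (@integral_law _ _ _ _ _ pi pi' swap (fun z => eucl_dist z.1 z.2))//.
  - by apply: eq_integral => z _; rewrite eucl_distC.
  - by apply: measurable_eucl_dist; [exact: measurable_fst|exact: measurable_snd].
  - by move=> z; exact: eucl_dist_ge0.
pose sq x := esq ((T i x : 'rV[R]_n) - T j x).
have SYT m x : S x -> (S `|` Y) (T m x) by move=> Sx; right; exact: (transport_range trT).
have msq : measurable_fun [set: _] sq by apply: measurable_esq; exact: measurable_subv.
have Isq : rho.-integrable S (EFin \o sq).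
  apply: (bounded_integrable hyp (M := D ^+ 2)) => // x Sx.
  by rewrite ger0_norm ?esq_ge0//; apply: (stability_esq_le hyp); exact: SYT.
have -> : (\int[rho]_x (esq ((T i x : 'rV[R]_n) - T j x))%:E =
    (\int[rho]_(x in S) sq x)%:E)%E.
  rewrite fineK; last exact: integrable_fin_num.
  by rewrite (integral_on_full mS (rho_on_source hyp))// => x; exact: esq_ge0.
rewrite -(fineK Ifin) -!EFinM lee_fin.
suff H (delta : R) : 0 < delta -> w i * \int[rho]_(x in S) sq x <= 4 * D * (fine I + delta).
  apply/ler_addgt0Pr => e e0.
  have := H (e / (4 * D)); rewrite divr_gt0 ?mulr_gt0// => /(_ isT) /le_trans; apply.
  by rewrite mulrDr mulrCA divff ?mulr1// mulf_neq0// gt_eqF.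
move=> d0.
have [Tj [mTj YTj lawTj dTj]] := competitor_near pi1 pi2 d0.
have [Ti [mTi YTi lawTi dTi]] := competitor_near pi1' pi2' d0.
rewrite I'E in dTi.
have perti := optimal_perturbation hyp SYy0 mTi YTi lawTi.
have pertj := optimal_perturbation hyp SYy0 mTj YTj lawTj.
pose e1 x := eucl_dist (T j x) (Ti x).
pose e2 x := eucl_dist (T i x) (Tj x).
have boundR (f : borelRn R n -> R) : measurable_fun [set: _] f ->
    (forall x, 0 <= f x) ->
    (forall x, S x -> f x <= D) -> (\int[rho]_x (f x)%:E <= I + delta%:E)%E ->
    rho.-integrable S (EFin \o f) /\ \int[rho]_(x in S) f x <= fine I + delta.
  move=> mf f0 fD fI.
  have If : rho.-integrable S (EFin \o f).
    apply: (bounded_integrable hyp (M := D)) => // x Sx.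
    by rewrite ger0_norm// fD.
  split=> //; rewrite -lee_fin fineK; last exact: integrable_fin_num.
  by rewrite (integral_on_full mS (rho_on_source hyp))// EFinD fineK.
have [Ie1 le1] : rho.-integrable S (EFin \o e1) /\ \int[rho]_(x in S) e1 x <= fine I + delta.
  apply: boundR => //; first exact: measurable_eucl_dist.
    by move=> x; exact: eucl_dist_ge0.
  by move=> x Sx; apply: (stability_dist_le hyp); [exact: SYT|right].
have [Ie2 le2] : rho.-integrable S (EFin \o e2) /\ \int[rho]_(x in S) e2 x <= fine I + delta.
  apply: boundR => //; first exact: measurable_eucl_dist.
    by move=> x; exact: eucl_dist_ge0.
  by move=> x Sx; apply: (stability_dist_le hyp); [exact: SYT|right].
have u_le x : S x -> Num.sqrt (esq (bary_dev lam T y0 x)) <= D.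
  move=> Sx; rewrite -[leRHS](ger0_norm (ltW D0)) -sqrtr_sqr.
  rewrite ler_wsqrtr//; apply: (esq_sum_le lam0 lam1) => m.
  by apply: (stability_esq_le hyp) => //; exact: (graph_pointSY _ trT).
pose g1 x := 2 * edot (bary_dev lam T y0 x) ((Ti x : 'rV[R]_n) - T i x)
      + w i * esq ((Ti x : 'rV[R]_n) - T i x).
pose g2 x := 2 * edot (bary_dev lam T y0 x) ((Tj x : 'rV[R]_n) - T j x)
      + w j * esq ((Tj x : 'rV[R]_n) - T j x).
have wm0 m : 0 <= w m by apply: ltW; exact: lam0.
have wm1 m : w m <= 1 by exact: weight_le1.
have g_le x : S x -> 2 * w i * sq x - 4 * D * (e1 x + e2 x) <= g1 x + g2 x.
  move=> Sx; rewrite /g1 /g2 -wij.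
  apply: swap_displacements_ge => //; first exact: u_le.
  by apply: (stability_dist_le hyp); exact: SYT.
have mbar : measurable_fun [set: borelRn R n] (bary_dev lam T y0 : borelRn R n -> borelRn R n).
  apply: measurable_sumv => m; apply: measurable_scalev.
  by apply: (measurable_subv (g := fun=> y0)) => //; exact: measurable_graph_point.
have g_bound m (Tm : borelRn R n -> borelRn R n) : measurable_fun [set: _] Tm ->
    (forall x, Y (Tm x)) -> rho.-integrable S (EFin \o (fun x =>
      2 * edot (bary_dev lam T y0 x) ((Tm x : 'rV[R]_n) - T m x)
      + w m * esq ((Tm x : 'rV[R]_n) - T m x))).
  move=> mTm YTm; apply: (bounded_integrable hyp (M := 2 * (D * D) + D ^+ 2)).
    have md : measurable_fun [set: _]
        ((fun x => (Tm x : 'rV[R]_n) - T m x) : borelRn R n -> borelRn R n).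
      exact: measurable_subv.
    apply: measurable_funD; apply: measurable_funM => //; first exact: measurable_edot.
    exact: measurable_esq.
  move=> x Sx; have SYm : (S `|` Y) (Tm x) by right.
  apply: le_trans (ler_normD _ _) _; apply: lerD.
    rewrite normrM ger0_norm// ler_wpM2l//; apply: le_trans (edot_le _ _) _.
    apply: ler_pM; rewrite ?sqrtr_ge0 ?u_le// -eucl_distE.
    by apply: (stability_dist_le hyp) => //; exact: SYT.
  rewrite ger0_norm ?mulr_ge0 ?esq_ge0//; apply: le_trans (_ : esq ((Tm x : 'rV[R]_n) - T m x) <= _).
    by rewrite ler_piMl ?esq_ge0.
  by apply: (stability_esq_le hyp) => //; exact: SYT.
have Ig1 := g_bound i Ti mTi YTi.
have Ig2 := g_bound j Tj mTj YTj.
have Ie : rho.-integrable S (EFin \o (fun x => e1 x + e2 x)).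
  by have := integrableD mS Ie1 Ie2; apply: eq_integrable.
have IeZ : rho.-integrable S (EFin \o (fun x => 4 * D * (e1 x + e2 x))).
  by have := integrableZl mS (4 * D) Ie; apply: eq_integrable.
have IsZ : rho.-integrable S (EFin \o (fun x => 2 * w i * sq x)).
  by have := integrableZl mS (2 * w i) Isq; apply: eq_integrable.
have Ilow : rho.-integrable S (EFin \o (fun x => 2 * w i * sq x - 4 * D * (e1 x + e2 x))).
  by have := integrableB mS IsZ IeZ; apply: eq_integrable.
have Ig : rho.-integrable S (EFin \o (fun x => g1 x + g2 x)).
  by have := integrableD mS Ig1 Ig2; apply: eq_integrable.
have := le_Rintegral mS Ilow Ig g_le.
rewrite (RintegralB mS IsZ IeZ) (RintegralZl _ mS Isq) (RintegralZl _ mS Ie).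
rewrite (RintegralD mS Ie1 Ie2) (RintegralD mS Ig1 Ig2) => main.
have DE : 4 * D * (\int[rho]_(x in S) e1 x + \int[rho]_(x in S) e2 x) <=
    4 * D * ((fine I + delta) + (fine I + delta)).
  by rewrite ler_wpM2l ?mulr_ge0 ?(ltW D0)// lerD.
have p12 : \int[rho]_(x in S) g1 x + \int[rho]_(x in S) g2 x <= 0.
  by rewrite -[leRHS]addr0; exact: lerD perti pertj.
move: (le_trans main p12) DE; rewrite -(mulrA 2 (w i)) -!(mulrA 4).
rewrite (mulrDr D (fine I + delta)); clear.
move: (w i * \int[rho]_(x in S) sq x) => A.
move: (D * (_ + \int[rho]_(x in S) e2 x)) (D * (_ + delta)) => B C.
by lra.
Qed.

End pair.

(** * The stability estimates *)

Section ereal_power.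
Variable R : realType.
Implicit Types (x y : \bar R) (a r : R).

Lemma le_poweR x y r : 0 <= r -> (0 <= x)%E -> (x <= y)%E -> (x `^ r <= y `^ r)%E.
Proof.
move=> r0 x0 xy; apply: (gt0_ler_poweR r0) => //; rewrite in_itv/= leey andbT//.
exact: le_trans x0 xy.
Qed.

Lemma mule_sqrt_poweR a x : 0 <= a -> (0 <= x)%E ->
  (a%:E * x `^ 2^-1 = ((a ^+ 2)%:E * x) `^ 2^-1)%E.
Proof.
move=> a0 x0; rewrite poweRM ?lee_fin ?sqr_ge0// poweR_EFin powR12_sqrt ?sqr_ge0//.
by congr (_%:E * _)%E; have := sqrtr_sqr a; rewrite ger0_norm.
Qed.

End ereal_power.

Section pair_estimate.
Variables (R : realType) (n : nat).

Lemma L2_distE (rho : probability (borelRn R n) R) (f g : borelRn R n -> borelRn R n) :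
  L2_dist rho f g = ((\int[rho]_x (esq ((f x : 'rV[R]_n) - g x))%:E) `^ 2^-1)%E.
Proof.
rewrite /L2_dist unlock; congr (_ `^ _)%E; apply: eq_integral => x _.
rewrite gee0_abs ?lee_fin ?eucl_dist_ge0// poweR_EFin -sqr_eucl_dist.
by rewrite -(powR_mulrn 2)// eucl_dist_ge0.
Qed.

Lemma wasserstein1_ge0 (mu nu : probability (borelRn R n) R) :
  (0 <= wasserstein1 mu nu)%E.
Proof.
apply: le_ereal_inf_tmp => _ [pi _ <-].
by apply: integral_ge0 => z _; rewrite lee_fin eucl_dist_ge0.
Qed.

Variables (l0 : 'I_n) (k : nat).
Variables (lam : 'I_k.+1 -> R) (S Y : set 'rV[R]_n)
    (rho : probability (borelRn R n) R) (mu : 'I_k -> probability (borelRn R n) R)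
    (T : 'I_k -> borelRn R n -> borelRn R n) (i j : 'I_k).
Hypotheses (hyp : mm_setting lam S Y rho mu T)
  (lamij : lam (lift ord0 i) = lam (lift ord0 j)).

Lemma pair_sqr_le :
  (\int[rho]_x (esq ((T i x : 'rV[R]_n) - T j x))%:E <=
   (4 * (eucl_diam (S `|` Y) + 1) / lam (lift ord0 i))%:E * wasserstein1 (mu i) (mu j))%E.
Proof.
set D := eucl_diam _ + 1; set w := lam _.
have w0 : 0 < w := weights_gt0 hyp _.
have D0 : 0 < D := diam_pos hyp.
set E2 := (\int[rho]_x _)%E.
have c0 : 0 < w / (4 * D) by rewrite divr_gt0// mulr_gt0.
have cV : 4 * D / w = (w / (4 * D))^-1 by rewrite invf_div.
rewrite cV -(@lee_pmul2l _ (w / (4 * D))%:E) ?fin_num_fine// ?lte_fin//.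
rewrite muleA -EFinM divff ?gt_eqF// mul1e.
apply: le_ereal_inf_tmp => _ [pi cpi <-].
have -> : w / (4 * D) = (4 * D)^-1 * w by rewrite mulrC.
rewrite EFinM -muleA.
have D40 : 0 < 4 * D by rewrite mulr_gt0.
apply: le_trans (_ : ((4 * D)^-1)%:E * ((4 * D)%:E * \int[pi]_z (eucl_dist z.1 z.2)%:E) <= _)%E.
  by apply: lee_wpmul2l; [rewrite lee_fin invr_ge0 ltW|exact: (pair_energy_le l0 hyp)].
by rewrite muleA -EFinM mulVf ?gt_eqF// mul1e.
Qed.

Let dist2_ge0 : (0 <= \int[rho]_x (esq ((T i x : 'rV[R]_n) - T j x))%:E)%E.
Proof. by apply: integral_ge0 => x _; rewrite lee_fin esq_ge0. Qed.

Lemma pair_L2_le : (L2_dist rho (T i) (T j) <=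
  ((4 * (eucl_diam (S `|` Y) + 1) / lam (lift ord0 i)) `^ 2^-1)%:E *
   wasserstein1 (mu i) (mu j) `^ 2^-1)%E.
Proof.
rewrite L2_distE -poweR_EFin -poweRM ?wasserstein1_ge0//; last first.
  rewrite lee_fin divr_ge0// ?mulr_ge0// ltW//; first exact: (diam_pos hyp).
  exact: (weights_gt0 hyp).
by apply: le_poweR => //; exact: pair_sqr_le.
Qed.

(** The factor [lam ^ (-1/2)] of the previous estimate becomes [lam ^ (1/2)] after
multiplication by the weight; it goes with [W_1] under the square root. *)
Lemma weighted_pair_L2_le : ((lam (lift ord0 i))%:E * L2_dist rho (T i) (T j) <=
  ((4 * (eucl_diam (S `|` Y) + 1)) `^ 2^-1)%:E *
   ((lam (lift ord0 i))%:E * wasserstein1 (mu i) (mu j)) `^ 2^-1)%E.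
Proof.
have w0 := weights_gt0 hyp (lift ord0 i); have D0 := diam_pos hyp.
set w := lam _ in w0 *; set D := eucl_diam _ + 1 in D0 *.
have WW := wasserstein1_ge0 (mu i) (mu j).
rewrite L2_distE mule_sqrt_poweR ?(ltW w0)// -poweR_EFin -poweRM ?lee_fin//; last 2 first.
  - by rewrite mulr_ge0// ltW.
  - by rewrite mule_ge0// lee_fin ltW.
apply: le_poweR => //; first by rewrite mule_ge0// lee_fin sqr_ge0.
rewrite muleA -EFinM.
have -> : 4 * D * w = w ^+ 2 * (4 * D / w) by field; rewrite gt_eqF.
rewrite (EFinM (w ^+ 2)) -muleA; apply: lee_wpmul2l; first by rewrite lee_fin sqr_ge0.
exact: pair_sqr_le.
Qed.

End pair_estimate.

(** The pair estimate requires the square root of [8 * (D + 1)] and the one with a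
permutation requires [N - 1] times the square root of [4 * (D + 1)]. The absolute
value makes the constant positive for every real [D]. *)
Definition stability_constant (R : realType) (N : nat) (D : R) : R :=
  N.+1%:R * (8 * (`|D| + 1)) `^ 2^-1.

Lemma stability_constant_gt0 (R : realType) N (D : R) : 0 < stability_constant N D.
Proof. by rewrite mulr_gt0// powR_gt0// mulr_gt0// ltr_wpDl. Qed.

Lemma stability_pair (R : realType) (k n : nat) : (1 <= n)%N ->
  pair_estimate k n (@stability_constant R k.+1) (- 2^-1) 2^-1.
Proof.
move=> n0 lam S Y rho mu T i j hyp lamij.
apply: le_trans (pair_L2_le (Ordinal n0) hyp lamij) _.
apply: lee_wpmul2r; first exact: poweR_ge0.
rewrite lee_fin /stability_constant -lamij.
have w0 := weights_gt0 hyp (lift ord0 i); have D0 := diam_pos hyp.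
set w := lam _ in w0 *; set D := eucl_diam _ in D0 *.
rewrite powRN !powR12_sqrt ?divr_ge0 ?mulr_ge0 ?(ltW D0) ?addr_ge0 ?(ltW w0)//.
have -> : 4 * (D + 1) / w = 8 * (D + 1) / (w + w) by field; rewrite !gt_eqF ?addr_gt0.
rewrite sqrtrM ?mulr_ge0 ?(ltW D0)// sqrtrV ?addr_ge0 ?(ltW w0)//.
rewrite ler_wpM2r ?invr_ge0 ?sqrtr_ge0//.
apply: le_trans (_ : 1 * Num.sqrt (8 * (`|D| + 1)) <= _).
  by rewrite mul1r ler_wsqrtr// ler_wpM2l// lerD2r ler_norm.
by rewrite ler_wpM2r ?sqrtr_ge0// ler1n.
Qed.

(** Each of the terms of the sum is at most the square root of the whole sum of
the weighted distances, up to the constant. *)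
Lemma stability_permutation (R : realType) (k n : nat) : (1 <= n)%N ->
  permutation_estimate k n (@stability_constant R k.+1) 2^-1.
Proof.
move=> n0 lam S Y rho mu T sigma hyp lam_sigma.
set D := eucl_diam _; set W := (\sum_(i < k) _ * wasserstein1 _ _)%E.
have D0 : 0 < D + 1 := diam_pos hyp.
have lam0 := weights_gt0 hyp.
have term_le i : ((lam (lift ord0 i))%:E * L2_dist rho (T i) (T (sigma i)) <=
    ((4 * (D + 1)) `^ 2^-1)%:E * W `^ 2^-1)%E.
  apply: le_trans (weighted_pair_L2_le (Ordinal n0) hyp _) _; first by rewrite lam_sigma.
  apply: lee_wpmul2l; first by rewrite lee_fin powR_ge0.
  have t0 m : (0 <= (lam (lift ord0 m))%:E * wasserstein1 (mu m) (mu (sigma m)))%E.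
    by rewrite mule_ge0 ?wasserstein1_ge0// lee_fin ltW.
  apply: le_poweR => //; rewrite /W (bigD1 i)//= leeDl//.
  by apply: sume_ge0 => m _.
apply: le_trans (lee_sum _ (fun i _ => term_le i)) _.
set c := (_ * _)%E.
have -> : (\sum_(i < k) c = k%:R%:E * c)%E.
  under eq_bigr do rewrite -(mul1e c).
  by rewrite -ge0_sume_distrl// sumEFin sumr_const card_ord.
rewrite /c muleA.
apply: lee_wpmul2r; first exact: poweR_ge0.
rewrite -EFinM lee_fin /stability_constant.
apply: ler_pM; rewrite ?powR_ge0 ?ler_nat ?leqW//.
rewrite !powR12_sqrt ?mulr_ge0 ?(ltW D0) ?addr_ge0// ler_wsqrtr//.
by apply: ler_pM; rewrite ?(ltW D0) ?ler_nat// lerD2r ler_norm.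
Qed.

(** * Product laws *)

Section product_law.
Variable R : realType.
Local Notation RT := (measurableTypeR R).

Lemma uniform_law (D : set R) (c : R) : measurable D -> 0 < c ->
  lebesgue_measure D = c%:E ->
  exists nu : probability RT R, forall A, measurable A ->
    nu A = (c^-1%:E * lebesgue_measure (A `&` D))%E.
Proof.
move=> mD c0 Dc.
have c1 : 0 <= c^-1 by rewrite invr_ge0 ltW.
pose m : {measure set RT -> \bar R} :=
  mscale (NngNum c1) (mrestr (@lebesgue_measure R) mD).
have mT : m setT = 1%E.
  by rewrite /m /= /mscale /= /mrestr /= setTI Dc -EFinM mulVf// gt_eqF.
pose P : probability RT R := HB.pack (m : set RT -> \bar R)
  (Measure.class m) (Measure_isProbability.Build _ _ _ m mT).
by exists P.
Qed.

(** By induction on the dimension: the first coordinate is independent of the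
others, and the pair is read as a vector. *)
Lemma product_law n (nu : 'I_n -> probability RT R) :
  exists rho : probability (borelRn R n) R, forall A : 'I_n -> set R,
    (forall l, measurable (A l)) ->
    rho [set x : 'rV[R]_n | forall l, A l (x ord0 l)] =
      (\prod_l fine (nu l (A l)))%:E.
Proof.
elim: n nu => [nu|n IH nu].
  pose P : probability (borelRn R 0) R := dirac ((0 : 'rV[R]_0) : borelRn R 0).
  exists P => A mA; rewrite big_ord0.
  rewrite (_ : [set x | _] = setT); first exact: (probability_setT P).
  by apply/seteqP; split => // x _ [].
have [rho rhoE] := IH (fun l => nu (lift ord0 l)).
pose Q : probability (RT * borelRn R n)%type R := (nu ord0 \x rho)%E.
pose f (z : RT * borelRn R n) : borelRn R n.+1 :=
  \row_l (if unlift ord0 l is Some l' then (z.2 : 'rV[R]_n) ord0 l' else z.1).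
have mf : measurable_fun setT f.
  apply: measurable_to_rV => l; rewrite /f.
  under eq_fun do rewrite mxE.
  case: unliftP => [l' _|_]; last exact: measurable_fst.
  by apply: measurable_coord_comp; exact: measurable_snd.
have [mu muE] := pushforward_probability Q mf.
exists mu => A mA; rewrite muE big_ord_recl EFinM -rhoE//.
have -> : f @^-1` [set x : 'rV[R]_n.+1 | forall l, A l (x ord0 l)] =
  A ord0 `*` [set x : 'rV[R]_n | forall l, A (lift ord0 l) (x ord0 l)].
  apply/seteqP; split => [z /= Az|z /= [A0 AS] l].
    split=> [|l]; first by have := Az ord0; rewrite mxE unlift_none.
    by have := Az (lift ord0 l); rewrite mxE liftK.
  by rewrite mxE; case: unliftP => [l' ->|->].
rewrite /Q /= product_measure1E//; last first.
  rewrite (_ : [set x | _] = \bigcap_(l in [set: 'I_n])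
    ((fun x : borelRn R n => (x : 'rV[R]_n) ord0 l) @^-1` A (lift ord0 l))).
    apply: fin_bigcap_measurable => // l _.
    by rewrite -[X in measurable X]setTI; apply: measurable_coord.
  by apply/seteqP; split => x /= Ax l; [move=> _|]; exact: Ax.
  exact: mA.
by rewrite fineK// fin_num_measure//; exact: mA.
Qed.

Lemma measurable_rect n (A : 'I_n -> set R) : (forall l, measurable (A l)) ->
  measurable ([set x | forall l, A l ((x : 'rV[R]_n) ord0 l)] : set (borelRn R n)).
Proof.
move=> mA; rewrite (_ : [set x | _] = \bigcap_(l in [set: 'I_n])
    ((fun x : borelRn R n => (x : 'rV[R]_n) ord0 l) @^-1` A l)).
  apply: fin_bigcap_measurable => // l _.
  by rewrite -[X in measurable X]setTI; apply: measurable_coord.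
by apply/seteqP; split => x /= Ax l; [move=> _|]; exact: Ax.
Qed.

(** A measure whose value on boxes is at most a multiple of their volume is
absolutely continuous, by subadditivity along coverings by boxes. *)
Lemma dominated_by_volume n (rho : probability (borelRn R n) R) (K : R) : 0 < K ->
  (forall a b, (rho (box a b) <= (K * box_volume a b)%:E)%E) ->
  rho `<< @lebesgueRn R n.
Proof.
move=> K0 rho_box N N0 A mA AN.
have mbox (a b : 'rV[R]_n) : measurable (box a b : set (borelRn R n)).
  rewrite (_ : box a b = [set x | forall l, `[a ord0 l, b ord0 l]%classic (x ord0 l)]).
    by apply: (@measurable_rect _ (fun l => `[a ord0 l, b ord0 l]%classic)) => l.
  by apply/seteqP; split => x /= bx l; have := bx l; rewrite /= in_itv.
have LA : lebesgueRn A = 0%E by apply: N0.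
apply/eqP; rewrite eq_le measure_ge0 andbT.
apply/lee_addgt0Pr => e e0; rewrite add0e.
have eK : 0 < e / K by rewrite divr_gt0.
have [_ [ab /= Aab <-]] : exists2 x, [set (\sum_(0 <= j <oo) (box_volume (ab j).1 (ab j).2)%:E)%E |
             ab in [set ab : nat -> 'rV[R]_n * 'rV[R]_n |
                    A `<=` \bigcup_j box (ab j).1 (ab j).2]] x & (x < (e / K)%:E)%E.
  have := @lb_ereal_inf_adherent R [set (\sum_(0 <= j <oo) (box_volume (ab j).1 (ab j).2)%:E)%E |
             ab in [set ab : nat -> 'rV[R]_n * 'rV[R]_n |
                    A `<=` \bigcup_j box (ab j).1 (ab j).2]] _ eK.
  by rewrite -/(lebesgueRn A) LA add0e; apply.
move=> sum_lt.
apply: le_trans (_ : \sum_(0 <= j <oo) rho (box (ab j).1 (ab j).2) <= _)%E.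
  exact: measure_sigma_subadditive.
apply: le_trans (_ : \sum_(0 <= j <oo) (K%:E * (box_volume (ab j).1 (ab j).2)%:E) <= _)%E.
  by apply: lee_nneseries => j _ //; rewrite -EFinM; exact: rho_box.
have vol0 j : (0 <= (box_volume (ab j).1 (ab j).2)%:E)%E.
  by rewrite lee_fin; apply: prodr_ge0 => l _; rewrite le_max lexx.
rewrite nneseriesZl//.
apply: le_trans (_ : K%:E * (e / K)%:E <= _)%E.
  by apply: lee_wpmul2l; [rewrite lee_fin ltW|exact: ltW].
by rewrite -EFinM mulrCA divff ?mulr1// gt_eqF.
Qed.

(** The product of the uniform laws on the [D l]; its density is bounded by the
inverse of the volume of their product, whence the absolute continuity. *)
Lemma uniform_product_law n (D : 'I_n -> set R) (c : 'I_n -> R) :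
  (forall l, measurable (D l)) -> (forall l, 0 < c l) ->
  (forall l, lebesgue_measure (D l) = (c l)%:E) ->
  exists rho : probability (borelRn R n) R,
  [/\ rho `<< @lebesgueRn R n,
      rho [set x : 'rV[R]_n | forall l, D l (x ord0 l)] = 1%E &
      forall l (B : set R), measurable B ->
        rho [set x : 'rV[R]_n | B (x ord0 l)] =
        ((c l)^-1%:E * lebesgue_measure (B `&` D l))%E].
Proof.
move=> mD c0 Dc.
have [nu nuE] := choice (fun l => uniform_law (mD l) (c0 l) (Dc l)).
have nuT l : nu l setT = 1%E by exact: (probability_setT (nu l)).
have [rho rhoE] := product_law nu.
exists rho; split.
- apply: (@dominated_by_volume _ _ (\prod_l (c l)^-1)).
    by apply: prodr_gt0 => l _; rewrite invr_gt0.
  move=> a b; rewrite (_ : box a b =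
      [set x | forall l, `[a ord0 l, b ord0 l]%classic (x ord0 l)]); last first.
    by apply/seteqP; split => x /= bx l; have := bx l; rewrite /= in_itv.
  rewrite (rhoE (fun l => `[a ord0 l, b ord0 l]%classic))// lee_fin /box_volume -big_split /=.
  apply: ler_prod => l _; rewrite fine_ge0//= -lee_fin fineK ?fin_num_measure//.
  rewrite nuE// EFinM; apply: lee_wpmul2l; first by rewrite lee_fin invr_ge0 ltW.
  apply: le_trans (_ : lebesgue_measure `[a ord0 l, b ord0 l]%classic <= _)%E.
    apply: le_measure; rewrite ?inE; last by move=> x [].
      by apply: measurableI; [exact: measurable_itv|exact: mD].
    exact: measurable_itv.
  rewrite lebesgue_measure_itv /= lte_fin; case: ifPn => ab.
    by rewrite -EFinB lee_fin le_max lexx orbT.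
  by rewrite lee_fin le_max lexx.
- rewrite (rhoE D)// big1// => l _.
  by rewrite nuE; [rewrite setIid Dc -EFinM mulVf// gt_eqF|exact: mD].
move=> l B mB; rewrite (_ : [set x : 'rV[R]_n | B (x ord0 l)] =
    [set x | forall m, (if m == l then B else setT) (x ord0 m)]); last first.
  apply/seteqP; split => [x /= Bx m|x /= /(_ l)]; last by rewrite eqxx.
  by case: eqVneq => // ->.
rewrite (rhoE (fun m => if m == l then B else setT)) => [|m]; last by case: eqP.
rewrite (bigD1 l)//= eqxx big1 ?mulr1 => [|m /negbTE ->]; last by rewrite nuT.
by rewrite fineK ?fin_num_measure// nuE.
Qed.

End product_law.

(** * A criterion for optimality *)

Lemma wasserstein1_le_maps (R : realType) n (rho mu nu : probability (borelRn R n) R)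
    (f g : borelRn R n -> borelRn R n) :
  measurable_fun setT f -> measurable_fun setT g ->
  (forall A, measurable A -> mu A = rho (f @^-1` A)) ->
  (forall A, measurable A -> nu A = rho (g @^-1` A)) ->
  (wasserstein1 mu nu <= \int[rho]_x (eucl_dist (f x) (g x))%:E)%E.
Proof.
move=> mf mg muE nuE.
have mfg : measurable_fun setT (fun x => (f x, g x)) by exact: measurable_fun_pair.
have [pi piE] := pushforward_probability rho mfg.
apply: ereal_inf_lbound; exists pi.
  by move=> A mA; rewrite /pushforward !piE muE// nuE.
rewrite (@integral_law _ _ _ _ _ rho pi (fun x => (f x, g x)) (fun z => eucl_dist z.1 z.2))//.
  by apply: measurable_eucl_dist; [exact: measurable_fst|exact: measurable_snd].
by move=> z; exact: eucl_dist_ge0.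
Qed.

Section pointwise.
Variables (R : realType) (k n : nat) (lam : 'I_k.+1 -> R)
    (S Y : set 'rV[R]_n) (rho : probability (borelRn R n) R)
    (mu : 'I_k -> probability (borelRn R n) R)
    (T : 'I_k -> borelRn R n -> borelRn R n) (V : 'I_k -> set 'rV[R]_n).

(** When each marginal is carried by a set [V i] and the maps minimise the cost
pointwise among all choices of targets in these sets, they are optimal: any
competitor also takes its values in the [V i] almost everywhere. *)
Lemma mm_setting_of_pointwise :
  (forall i, 0 < lam i) -> \sum_i lam i = 1 ->
  compact S -> compact Y -> rho S = 1%E -> rho `<< @lebesgueRn R n ->
  (forall i, measurable (V i : set (borelRn R n))) -> (forall i, V i `<=` Y) ->
  (forall i, measurable_fun setT (T i)) -> (forall i x, V i (T i x)) ->
  (forall i A, measurable A -> mu i A = rho (T i @^-1` A)) ->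
  (forall x z, S x -> (forall i, V i (z i)) ->
     bary_cost lam (graph_point T x) <=
     bary_cost lam (graph_point (fun i _ => z i) x)) ->
  mm_setting lam S Y rho mu T.
Proof.
move=> lam0 lam1 cS cY rhoS rhoac mV VY mT TV muE opt.
have mS := measurable_compact_rV cS.
have mY := measurable_compact_rV cY.
have full i (A : set 'rV[R]_n) : measurable (A : set (borelRn R n)) ->
    (forall x, A (T i x)) -> mu i A = 1%E.
  move=> mA TA; rewrite muE// (_ : T i @^-1` A = setT); first exact: (probability_setT rho).
  by apply/seteqP; split => // x _; exact: TA.
have onY i : mu i Y = 1%E by apply: full => // x; apply: VY; exact: TV.
suff optT : mm_optimal_maps lam S Y rho mu T by split.
split; first split.
- exact: mT.
- by move=> i x _; apply: VY; exact: TV.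
- by move=> i A mA; rewrite muE.
move=> T' trT'; rewrite /mm_cost.
have mT' := transport_measurable trT'.
apply: ae_ge0_le_integral => //.
- by move=> x _; rewrite lee_fin bary_cost_ge0.
- by apply/measurable_EFinP/measurable_funTS; exact: measurable_bary_cost.
- by move=> x _; rewrite lee_fin bary_cost_ge0.
- by apply/measurable_EFinP/measurable_funTS; exact: measurable_bary_cost.
have : {ae rho, forall x, forall i, V i (T' i x)}.
  apply: filter_forall => i.
  apply: (full_ae (E := T' i @^-1` V i)) => //.
    by rewrite -[X in measurable X]setTI; exact: mT'.
  by have := transport_pushforward trT' i (mV i); rewrite /pushforward => ->; exact: full.
apply: filterS => x VT' Sx; rewrite lee_fin.
rewrite (_ : graph_point T' x = graph_point (fun i _ => T' i x) x).
  exact: opt.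
by apply/funext => i; rewrite /graph_point; case: unlift.
Qed.

End pointwise.

Section two_maps.
Variables (R : realType) (k n : nat) (i0 j0 : 'I_k) (t : R).
Hypotheses (ij : i0 != j0) (t0 : 0 < t) (t1 : k%:R * t <= 2^-1).

Definition equal_weights (i : 'I_k.+1) : R := if i == ord0 then 1 - k%:R * t else t.

Lemma equal_weights0 : equal_weights ord0 = 1 - k%:R * t.
Proof. by rewrite /equal_weights eqxx. Qed.

Lemma equal_weightsS i : equal_weights (lift ord0 i) = t.
Proof. by []. Qed.

Lemma equal_weights_gt0 i : 0 < equal_weights i.
Proof. rewrite /equal_weights; case: eqP => // _.
by rewrite subr_gt0 (le_lt_trans t1)//; lra.
Qed.

Lemma sum_equal_weights : \sum_i equal_weights i = 1.
Proof.
rewrite big_ord_recl equal_weights0 (eq_bigr (fun=> t)) => [|i _]; last exact: equal_weightsS.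
by rewrite sumr_const card_ord -(mulr_natl t) subrK.
Qed.

(** Every other target is the Dirac mass at 0, which decouples it from the
minimisation. *)
Definition two_maps (f g : borelRn R n -> borelRn R n) (i : 'I_k) : borelRn R n -> borelRn R n :=
  if i == i0 then f else if i == j0 then g else fun=> (0 : 'rV[R]_n).

Lemma two_maps_i f g : two_maps f g i0 = f.
Proof. by rewrite /two_maps eqxx. Qed.

Lemma two_maps_j f g : two_maps f g j0 = g.
Proof. by rewrite /two_maps eq_sym (negbTE ij) eqxx. Qed.

Lemma sum_two (W : zmodType) (F : 'I_k -> W) :
  (forall i, i != i0 -> i != j0 -> F i = 0) -> \sum_i F i = F i0 + F j0.
Proof.
move=> F0; rewrite (bigD1 i0)//= (bigD1 j0)//=; last by rewrite eq_sym.
by rewrite big1 ?addr0// => i /andP[]; exact: F0.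
Qed.

(** The part of the cost which depends on the targets [a] and [b] of [x], divided
by [t]. *)
Definition two_cost (x a b : 'rV[R]_n) : R :=
  (1 - t) / 2 * (esq a + esq b) - (1 - k%:R * t) * edot x (a + b) - t * edot a b.

Lemma bary_cost_two x (z : 'I_k -> 'rV[R]_n) :
  (forall i, i != i0 -> i != j0 -> z i = 0) ->
  bary_cost equal_weights (graph_point (fun i _ => z i) x) =
  (1 - k%:R * t) * (k%:R * t) / 2 * esq x + t * two_cost x (z i0) (z j0).
Proof.
move=> z0; rewrite (bary_costE _ 0 sum_equal_weights).
rewrite big_ord_recl (big_ord_recl k) !equal_weights0 graph_point0 !subr0.
under eq_bigr do rewrite equal_weightsS graph_pointS subr0.
under [X in esq (_ + X)]eq_bigr do rewrite equal_weightsS graph_pointS subr0.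
rewrite !sum_two; [|by move=> i ii ji; rewrite z0// scaler0
  |by move=> i ii ji; rewrite z0// esq0 mulr0].
rewrite /two_cost; move: (k%:R * t) (z i0) (z j0) => c a b.
rewrite [esq (_ + (_ + _))]/esq !edotE (edotC a x) (edotC b x) (edotC b a) -!/(esq _).
by field.
Qed.

Variables (S Y : set 'rV[R]_n) (rho : probability (borelRn R n) R)
    (f g : borelRn R n -> borelRn R n) (V W : set 'rV[R]_n)
    (mu : 'I_k -> probability (borelRn R n) R).

Lemma two_maps_setting : compact S -> compact Y -> Y 0 ->
  rho S = 1%E -> rho `<< @lebesgueRn R n ->
  closed V -> closed W -> V `<=` Y -> W `<=` Y ->
  measurable_fun setT f -> measurable_fun setT g ->
  (forall x, V (f x)) -> (forall x, W (g x)) ->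
  (forall i A, measurable A -> mu i A = rho (two_maps f g i @^-1` A)) ->
  (forall x a b, S x -> V a -> W b -> two_cost x (f x) (g x) <= two_cost x a b) ->
  mm_setting equal_weights S Y rho mu (two_maps f g).
Proof.
move=> cS cY Y0 rhoS rhoac cV cW VY WY mf mg Vf Wg muE opt.
pose U i : set 'rV[R]_n := if i == i0 then V else if i == j0 then W else [set 0].
have cU i : closed (U i).
  rewrite /U; case: eqP => // _; case: eqP => // _.
  apply: (@accessible_closed_set1 'rV[R]_n); apply: hausdorff_accessible.
  exact: (@norm_hausdorff R 'rV[R]_n).
have Uf i x : U i (two_maps f g i x).
  by rewrite /U /two_maps; case: eqP => // _; case: eqP.
apply: (@mm_setting_of_pointwise _ _ _ _ _ _ _ _ _ U) => //.
- exact: equal_weights_gt0.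
- exact: sum_equal_weights.
- by move=> i; exact: measurable_closed_rV.
- by move=> i; rewrite /U; case: eqP => // _; case: eqP => // _ _ ->.
- by move=> i; rewrite /two_maps; case: eqP => // _; case: eqP.
have U0 i z : i != i0 -> i != j0 -> U i z -> z = 0.
  by rewrite /U => /negbTE -> /negbTE ->.
move=> x z Sx Uz.
rewrite (_ : graph_point (two_maps f g) x =
    graph_point (fun i _ => two_maps f g i x) x); last first.
  by apply/funext => i; rewrite /graph_point; case: unlift.
rewrite !bary_cost_two.
- rewrite two_maps_i two_maps_j lerD2l ler_pM2l//; apply: opt => //.
    by have := Uz i0; rewrite /U eqxx.
  by have := Uz j0; rewrite /U eq_sym (negbTE ij) eqxx.
- by move=> i ii ji; apply: (U0 i).
- by move=> i ii ji; apply: (U0 i).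
Qed.

End two_maps.

(** * Two targets at small distance *)

Section tools.
Variables (R : realType) (n : nat).

Definition cube (r : R) : set 'rV[R]_n := [set x | forall l, `[- r, r]%classic (x ord0 l)].

Lemma compact_rect (D : 'I_n -> set R) : (forall l, compact (D l)) ->
  compact [set x : 'rV[R]_n | forall l, D l (x ord0 l)].
Proof. by move=> cD; apply: (@rV_compact _ _ D). Qed.

Lemma compact_cube r : compact (cube r).
Proof. by apply: (@compact_rect (fun=> `[- r, r]%classic)) => l; exact: segment_compact. Qed.

Lemma cubeP r (x : 'rV[R]_n) : cube r x <-> forall l, `|x ord0 l| <= r.
Proof. by split => h l; have := h l; rewrite /= in_itv/= ler_norml. Qed.

Definition unit_vec (l : 'I_n) : 'rV[R]_n := delta_mx ord0 l.

Lemma edot_unit x l : edot x (unit_vec l) = x ord0 l.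
Proof.
rewrite /edot (bigD1 l)//= mxE !eqxx mulr1 big1 ?addr0// => m ml.
by rewrite mxE (negbTE ml) andbF mulr0.
Qed.

Lemma edot0l (x : 'rV[R]_n) : edot 0 x = 0.
Proof. by apply: big1 => l _; rewrite mxE mul0r. Qed.

Lemma edot0r (x : 'rV[R]_n) : edot x 0 = 0.
Proof. by rewrite edotC edot0l. Qed.

Lemma closed_pair (a b : 'rV[R]_n) : closed [set a; b].
Proof.
have c1 (z : 'rV[R]_n) : closed [set z].
  apply: (@accessible_closed_set1 'rV[R]_n); apply: hausdorff_accessible.
  exact: (@norm_hausdorff R 'rV[R]_n).
exact: closedU.
Qed.

Lemma integral_if_cst (rho : probability (borelRn R n) R) (b : borelRn R n -> bool) (c : R) :
  measurable_fun setT b -> 0 <= c ->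
  (\int[rho]_x (if b x then c else 0)%:E = c%:E * rho [set x | b x])%E.
Proof.
move=> mb c0.
have mB : measurable [set x | b x].
  by rewrite -[X in measurable X]setTI; exact: (mb measurableT [set true]).
rewrite (eq_integral (fun x => (c%:E * (\1_[set x | b x] x)%:E)%E)); last first.
  move=> x _; rewrite -EFinM indicE; congr EFin.
  by case: ifPn => bx; [rewrite mem_set// mulr1|rewrite memNset ?mulr0//=; exact/negP].
rewrite ge0_integralZl//=; first by rewrite integral_indic// setIT.
exact/measurable_EFinP/measurable_indic.
Qed.

End tools.

Lemma small_power (R : realType) (c0 c1 gamma e0 : R) : 0 < c0 -> 0 < gamma -> 0 < e0 ->
  exists e, [/\ 0 < e, e <= e0 & c1 * e `^ gamma < c0].
Proof.
move=> c00 g0 e00.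
pose d := c0 / (2 * (`|c1| + 1)).
have n1 : 0 < `|c1| + 1 by rewrite ltr_wpDl.
have d0 : 0 < d by rewrite divr_gt0// mulr_gt0.
exists (Num.min e0 (d `^ gamma^-1)); split.
- by rewrite lt_min e00 powR_gt0.
- by rewrite ge_min lexx.
have : Num.min e0 (d `^ gamma^-1) `^ gamma <= d.
  rewrite -[leRHS](powRr1 (ltW d0)) -(mulVf (lt0r_neq0 g0)) powRrM.
  apply: ge0_ler_powR; rewrite ?nnegrE ?(ltW g0) ?powR_ge0//.
    by rewrite le_min (ltW e00) powR_ge0.
  by rewrite ge_min lexx orbT.
set p := _ `^ gamma => pd.
have p0 : 0 <= p by exact: powR_ge0.
apply: le_lt_trans (_ : (`|c1| + 1) * d < _).
  apply: le_trans (_ : `|c1| * p <= _); first by rewrite ler_wpM2r// ler_norm.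
  by apply: ler_pM => //; rewrite lerDl.
have -> : (`|c1| + 1) * d = c0 / 2 by rewrite /d; field; rewrite gt_eqF.
lra.
Qed.

Section first_example.
Variables (R : realType) (k n : nat) (i0 j0 : 'I_k) (l0 : 'I_n).
Hypotheses (ij : i0 != j0) (k2 : (2 <= k)%N).

Let t : R := (2 * k%:R)^-1.

Lemma half_weight : k%:R * t = 2^-1 :> R.
Proof. by rewrite /t invfM mulrCA divff ?mulr1// pnatr_eq0; case: (k) k2. Qed.

Lemma half_weight_gt0 : 0 < t.
Proof. by rewrite invr_gt0 mulr_gt0// ltr0n; case: (k) k2. Qed.

Lemma half_weight_le : t <= 4^-1.
Proof.
rewrite lef_pV2 ?posrE// ?mulr_gt0// ?ltr0n; last by case: (k) k2.
by rewrite -natrM ler_nat (leq_mul2l 2 2 k) k2.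
Qed.

(** All targets are zero, except one which charges a point [q *: unit_vec l0]
with mass [eps]; with this [q] the optimal map reaches it exactly on the slice
[1 - eps < x l0] of the cube. Then the squared L2 distance and W_1 are both of
order [eps]. *)
Lemma first_example (eps : R) : 0 < eps -> eps <= 2^-1 ->
  exists (S : set 'rV[R]_n) (rho : probability (borelRn R n) R)
    (mu : 'I_k -> probability (borelRn R n) R)
    (T : 'I_k -> borelRn R n -> borelRn R n), [/\ S `<=` @cube R n 2,
    mm_setting (@equal_weights R k t) S (@cube R n 2) rho mu T,
    ((2^-1 * eps `^ 2^-1)%:E <= L2_dist rho (T i0) (T j0))%E &
    forall i j, (wasserstein1 (mu i) (mu j) <= (2 * eps)%:E)%E].
Proof.
move=> e0 e1.
have t0 := half_weight_gt0; have t4 := half_weight_le; have kt := half_weight.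
pose q := (1 - eps) / (1 - t).
have t1 : 0 < 1 - t by lra.
have qt : (1 - t) * q = 1 - eps by rewrite /q mulrCA divff ?mulr1// gt_eqF.
have q1 : 2^-1 <= q by rewrite /q ler_pdivlMr//; lra.
have q2 : q <= 2 by rewrite /q ler_pdivrMr//; lra.
have q0 : 0 < q by lra.
pose D (l : 'I_n) : set R := `[0, 1]%classic.
have Dc l : lebesgue_measure (D l) = 1%:E.
  by rewrite lebesgue_measure_itv /= lte_fin ltr01 oppr0 adde0.
have [rho [rhoac rhoS rhoB]] := @uniform_product_law R n D (fun=> 1)
  (fun l => measurable_itv _) (fun l => ltr01) Dc.
pose S := [set x : 'rV[R]_n | forall l, D l (x ord0 l)].
pose u := q *: unit_vec R l0.
pose top (x : borelRn R n) : bool := 1 - eps < (x : 'rV[R]_n) ord0 l0.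
have mtop : measurable_fun setT top.
  by apply: measurable_fun_ltr => //; exact: measurable_coord.
pose f (x : borelRn R n) : borelRn R n := (0 : 'rV[R]_n).
pose g (x : borelRn R n) : borelRn R n := if top x then u else (0 : 'rV[R]_n).
have mf : measurable_fun setT f by exact: measurable_cst.
have mg : measurable_fun setT g by apply: measurable_fun_ifT.
pose T := two_maps i0 j0 f g.
have mT i : measurable_fun setT (T i).
  by rewrite /T /two_maps; case: eqP => // _; case: eqP.
have [mu muE] := choice (fun i => pushforward_probability rho (mT i)).
have rho_top : rho [set x | top x] = eps%:E.
  have := rhoB l0 `]1 - eps, +oo[%classic (measurable_itv _).
  rewrite invr1 mul1e (_ : `]1 - eps, +oo[%classic `&` D l0 = `]1 - eps, 1]%classic); last first.
    apply/seteqP; split => x; rewrite /D /= !in_itv/= ?andbT.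
      by move=> [-> /andP[]].
    by move=> /andP[h1 h2]; split => //; rewrite h2 andbT; lra.
  rewrite lebesgue_measure_itv /= lte_fin ifT; last lra.
  rewrite -EFinB (_ : 1 - (1 - eps) = eps); last lra.
  move=> <-; congr (rho _); apply/seteqP; split => x /=; by rewrite in_itv/= andbT.
have esq_u : esq u = q ^+ 2.
  rewrite /esq edotZl edotZr edot_unit mxE !eqxx mulr1 expr2 //.
have esq_f_g x : esq ((f x : 'rV[R]_n) - g x) = if top x then q ^+ 2 else 0.
  rewrite /f sub0r /esq edotNl edotNr opprK /g -/(esq _).
  by case: ifP => _; [exact: esq_u|exact: esq0].
have dist_T i j x : eucl_dist (T i x) (T j x) <= if top x then q else 0.
  have fg : eucl_dist (f x) (g x) = if top x then q else 0.
    rewrite eucl_distE esq_f_g; case: ifP => _; last by rewrite sqrtr0.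
    by rewrite sqrtr_sqr ger0_norm// ltW.
  have c0 : 0 <= if top x then q else 0 by case: ifP => // _; exact: ltW.
  have Tx m : T m x = f x \/ T m x = g x.
    by rewrite /T /two_maps; case: eqP => _; [left|case: eqP => _; [right|left]].
  case: (Tx i) => ->; case: (Tx j) => ->; [|by rewrite fg|by rewrite eucl_distC fg|];
    by rewrite eucl_dist_refl.
exists S, rho, mu, T; split.
- move=> x Sx; apply/cubeP => l; have := Sx l; rewrite /D /= in_itv/= ler_norml.
  by move=> /andP[h1 h2]; apply/andP; split; lra.
- have kt1 : k%:R * t <= 2^-1 by rewrite kt.
  apply: (@two_maps_setting R k n i0 j0 t ij t0 kt1 S _ rho f g [set 0] [set u; 0] mu) => //.
  + by apply: (compact_rect (D := D)) => l; exact: segment_compact.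
  + exact: compact_cube.
  + by apply/cubeP => l; rewrite mxE normr0.
  + rewrite -[[set 0]]setUid; exact: closed_pair.
  + exact: closed_pair.
  + by move=> _ ->; apply/cubeP => l; rewrite mxE normr0.
  + move=> _ [->|->]; apply/cubeP => l; rewrite !mxE ?normr0//.
    rewrite normrM (gtr0_norm q0); case: (_ && _); by rewrite ?normr1 ?normr0 ?mulr1 ?mulr0.
  + by move=> x; rewrite /g; case: ifP; [left|right].
  move=> x _ b Sx -> bE; rewrite /two_cost /f !add0r !edot0l !mulr0 !subr0 !esq0 !add0r kt.
  have costu : (1 - t) / 2 * esq u - (1 - 2^-1) * edot x u = 2^-1 * q * ((1 - eps) - x ord0 l0).
    rewrite esq_u edotZr edot_unit -qt; by field.
  have cost0 : (1 - t) / 2 * esq (0 : 'rV[R]_n) - (1 - 2^-1) * edot x 0 = 0.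
    by rewrite esq0 edot0r !mulr0 subr0.
  have qh : 0 < 2^-1 * q by rewrite mulr_gt0.
  rewrite /g; case: ifPn => tx; case: bE => ->; rewrite ?costu ?cost0//.
    by rewrite pmulr_rle0// subr_le0; exact: ltW.
  by rewrite pmulr_rge0// subr_ge0 leNgt.
- rewrite /T two_maps_i two_maps_j// L2_distE.
  under eq_integral do rewrite esq_f_g.
  rewrite integral_if_cst ?sqr_ge0// rho_top -EFinM poweR_EFin lee_fin.
  rewrite powRM ?sqr_ge0 ?(ltW e0)// ler_wpM2r ?powR_ge0//.
  by rewrite powR12_sqrt ?sqr_ge0// sqrtr_sqr ger0_norm// ltW.
move=> i j; apply: le_trans (wasserstein1_le_maps (mT i) (mT j) _ _) _.
- by move=> A _; exact: muE.
- by move=> A _; exact: muE.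
apply: le_trans (_ : \int[rho]_x (if top x then q else 0)%:E <= _)%E.
  apply: ge0_le_integral => //.
  - by move=> x _; rewrite lee_fin eucl_dist_ge0.
  - by apply/measurable_EFinP; exact: measurable_eucl_dist.
  - by apply/measurable_EFinP; exact: measurable_fun_ifT.
  - by move=> x _; rewrite lee_fin.
by rewrite integral_if_cst ?(ltW q0)// rho_top -EFinM lee_fin ler_pM2r.
Qed.

End first_example.

(** * Two misaligned targets *)

(** For a source of weight [1 - w] at height [y], choosing the targets by the
vertical coordinate gains more than the interaction of the targets costs plus
what the horizontal coordinate, at most [t], could gain. The slope [6 * t] of the
targets is chosen for this purpose. *)
Lemma slab_gain (R : realType) (t w y : R) : 0 < t -> w <= 2^-1 -> 2^-1 <= y ->
  t * (1 - (6 * t) ^+ 2) + (1 - w) * t <= (1 - w) * (6 * t * y).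
Proof.
move=> t0 w1 y1.
have : 0 <= (1 - w) * (6 * t) * (y - 2^-1) by rewrite !mulr_ge0//; lra.
have : 0 <= t * (6 * t) ^+ 2 by rewrite mulr_ge0 ?sqr_ge0// ltW.
have : 0 <= (2^-1 - w) * t by rewrite mulr_ge0 ?subr_ge0// ltW.
lra.
Qed.

Section second_example.
Variables (R : realType) (k n : nat) (i0 j0 : 'I_k) (l0 l1 : 'I_n).
Hypotheses (ij : i0 != j0) (l01 : l0 != l1).

(** The range of the vertical coordinate; the gap around 0 gives the source a definite
preference for one of two opposite points. *)
Definition two_slabs : set R := `[- 1, - 2^-1]%classic `|` `[2^-1, 1]%classic.

Lemma measurable_two_slabs : measurable two_slabs.
Proof. by apply: measurableU; exact: measurable_itv. Qed.

Lemma compact_two_slabs : compact two_slabs.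
Proof. by apply: compactU; exact: segment_compact. Qed.

Lemma two_slabs_pos : two_slabs `&` `]0, +oo[%classic = `[2^-1, 1]%classic.
Proof.
apply/seteqP; split => x; rewrite /two_slabs /= !in_itv /= ?andbT.
  by move=> [[/andP[h1 h2] h3|//]]; lra.
by move=> h; split; [right|move: h => /andP[h1 h2]; lra].
Qed.

Lemma lebesgue_slab (a b : R) : a <= b -> lebesgue_measure `[a, b]%classic = (b - a)%:E.
Proof.
rewrite lebesgue_measure_itv /= lte_fin le_eqVlt => /predU1P[->|->]//.
by rewrite ltxx subrr.
Qed.

Lemma lebesgue_two_slabs : lebesgue_measure two_slabs = 1%:E.
Proof.
rewrite measureU//; last first.
  by apply/seteqP; split => x //=; rewrite !in_itv/= => -[/andP[? ?] /andP[? ?]]; lra.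
have s1 : - 1 <= - 2^-1 :> R by lra.
have s2 : 2^-1 <= 1 :> R by lra.
rewrite [X in (X + _)%E](lebesgue_slab s1) [X in (_ + X)%E](lebesgue_slab s2).
by rewrite -EFinD; congr EFin; lra.
Qed.

Section swap_halves.
Variables (rho : probability (borelRn R n) R) (b : borelRn R n -> bool).
Hypotheses (mb : measurable_fun setT b) (rho_b : rho [set x | b x] = (2^-1)%:E).

(** Both values have probability one half, so exchanging them does not matter,
whether [A] contains none, one or both of them. *)
Lemma same_law_halves (u v : 'rV[R]_n) (A : set (borelRn R n)) :
  rho ((fun x => if b x then u else v) @^-1` A) =
  rho ((fun x => if b x then v else u) @^-1` A).
Proof.
have mB : measurable (b @^-1` [set true]).
  by rewrite -[X in measurable X]setTI; exact: mb.
have rho_nb : rho (~` [set x | b x]) = (2^-1)%:E.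
  rewrite (probability_setC rho mB) [X in (_ - X)%E]rho_b -EFinB.
  by congr EFin; lra.
have halves (a c : 'rV[R]_n) : A a -> ~ A c ->
    rho ((fun x => if b x then a else c) @^-1` A) = (2^-1)%:E /\
    rho ((fun x => if b x then c else a) @^-1` A) = (2^-1)%:E.
  move=> Aa Ac; split.
    rewrite -rho_b; congr (rho _); apply/seteqP; split => x /=; first by case: ifP.
    by move=> ->.
  rewrite -rho_nb; congr (rho _); apply/seteqP; split => x /=; first by case: ifP.
  by move=> /negP/negbTE ->.
have [Au|nAu] := pselect (A u); have [Av|nAv] := pselect (A v).
- congr (rho _); apply/seteqP; split => x /=; by case: ifP.
- by have [-> ->] := halves _ _ Au nAv.
- by have [-> ->] := halves _ _ Av nAu.
- congr (rho _); apply/seteqP; split => x /=; by case: ifP.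
Qed.

End swap_halves.

(** The source is concentrated near two vertical segments, each of the two
targets is a pair of opposite points, and these pairs are mirror images, at
distance of order [t] of one another. Sending a point to almost opposite targets
costs of the order of [t ^+ 2] in their interaction, and gains of the order of
[t * (6 * t)] in the interaction with the source. *)
Lemma second_example (t : R) : 0 < t -> k%:R * t <= 12^-1 -> t <= 12^-1 ->
  exists (S : set 'rV[R]_n) (rho : probability (borelRn R n) R)
    (mu : 'I_k -> probability (borelRn R n) R)
    (T : 'I_k -> borelRn R n -> borelRn R n), [/\ S `<=` @cube R n 2,
    mm_setting (@equal_weights R k t) S (@cube R n 2) rho mu T,
    L2_dist rho (T i0) (T j0) = 2%:E &
    (wasserstein1 (mu i0) (mu j0) <= (12 * t)%:E)%E].
Proof.
move=> t0 kt t12.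
pose D (l : 'I_n) : set R := if l == l0 then `[- t, t]%classic
  else if l == l1 then two_slabs else `[- 1, 1]%classic.
pose c (l : 'I_n) : R := if l == l0 then t - (- t) else if l == l1 then 1 else 1 - (- 1).
have mD l : measurable (D l).
  rewrite /D; case: eqP => _; first exact: measurable_itv.
  by case: eqP => _; [exact: measurable_two_slabs|exact: measurable_itv].
have c0 l : 0 < c l by rewrite /c; case: eqP => _; [lra|case: eqP => _; lra].
have Dc l : lebesgue_measure (D l) = (c l)%:E.
  rewrite /D /c; case: eqP => _; first by rewrite lebesgue_slab//; lra.
  by case: eqP => _; [exact: lebesgue_two_slabs|rewrite lebesgue_slab//; lra].
have [rho [rhoac rhoS rhoB]] := uniform_product_law mD c0 Dc.
pose S := [set x : 'rV[R]_n | forall l, D l (x ord0 l)].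
have cS : compact S.
  apply: (compact_rect (D := D)) => l; rewrite /D; case: eqP => _; first exact: segment_compact.
  by case: eqP => _; [exact: compact_two_slabs|exact: segment_compact].
pose p : 'rV[R]_n := unit_vec R l0 + (6 * t) *: unit_vec R l1.
pose p' : 'rV[R]_n := unit_vec R l0 - (6 * t) *: unit_vec R l1.
pose up (x : borelRn R n) : bool := 0 < (x : 'rV[R]_n) ord0 l1.
have mup : measurable_fun setT up.
  by apply: measurable_fun_ltr => //; exact: measurable_coord.
pose f (x : borelRn R n) : borelRn R n := if up x then p else - p.
pose g (x : borelRn R n) : borelRn R n := if up x then - p' else p'.
have mf : measurable_fun setT f by apply: measurable_fun_ifT.
have mg : measurable_fun setT g by apply: measurable_fun_ifT.
pose T := two_maps i0 j0 f g.
have mT i : measurable_fun setT (T i).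
  by rewrite /T /two_maps; case: eqP => // _; case: eqP.
have [mu muE] := choice (fun i => pushforward_probability rho (mT i)).
have rho_up : rho [set x | up x] = (2^-1)%:E.
  have := rhoB l1 `]0, +oo[%classic (measurable_itv _).
  rewrite /c /D eq_sym (negbTE l01) eqxx invr1 mul1e setIC two_slabs_pos.
  rewrite lebesgue_slab; last lra.
  rewrite (_ : 1 - 2^-1 = 2^-1 :> R); last lra.
  move=> <-; congr (rho _); apply/seteqP; split => x /=; by rewrite in_itv/= andbT.
have l10 : l1 == l0 = false by rewrite eq_sym; apply/negbTE.
have unit00 : esq (unit_vec R l0) = 1 by rewrite /esq edot_unit mxE !eqxx.
have unit11 : esq (unit_vec R l1) = 1 by rewrite /esq edot_unit mxE !eqxx.
have unit01 : edot (unit_vec R l0) (unit_vec R l1) = 0.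
  by rewrite edot_unit mxE eqxx l10.
have unit10 : edot (unit_vec R l1) (unit_vec R l0) = 0 by rewrite edotC.
have pp : esq p = 1 + (6 * t) ^+ 2.
  by rewrite /esq /p !edotE -!/(esq _) unit00 unit11 unit01 unit10; ring.
have pp' : esq p' = 1 + (6 * t) ^+ 2.
  by rewrite /esq /p' !edotE -!/(esq _) unit00 unit11 unit01 unit10; ring.
have p_p' : edot p p' = 1 - (6 * t) ^+ 2.
  by rewrite /p /p' !edotE -!/(esq _) unit00 unit11 unit01 unit10; ring.
have xp x : edot x p = x ord0 l0 + 6 * t * x ord0 l1.
  by rewrite /p !edotE !edot_unit.
have xp' x : edot x p' = x ord0 l0 - 6 * t * x ord0 l1.
  by rewrite /p' !edotE !edot_unit.
have cube_p (s : 'rV[R]_n) : s = p \/ s = p' -> cube 2 s.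
  move=> sp; apply/cubeP => l.
  have [d [s_d d1]] : exists d, s = unit_vec R l0 + d *: unit_vec R l1 /\ `|d| <= 1.
    case: sp => ->; [exists (6 * t)|exists (- (6 * t))]; split => //.
    - by rewrite ger0_norm; lra.
    - by rewrite /p' scaleNr.
    - by rewrite normrN ger0_norm; lra.
  have u1 m : `|unit_vec R m ord0 l| <= 1.
    by rewrite mxE; case: (_ && _); rewrite ?normr1 ?normr0.
  rewrite s_d mxE; apply: le_trans (ler_normD _ _) _.
  rewrite -[2]/(1 + 1 : R); apply: lerD => //.
  by rewrite mxE normrM -[1]mulr1; apply: ler_pM.
have cubeN (s : 'rV[R]_n) : cube 2 s -> cube 2 (- s).
  by move=> /cubeP h; apply/cubeP => l; rewrite mxE normrN.
have kt1 : k%:R * t <= 2^-1 by lra.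
clearbody p p'.
exists S, rho, mu, T; split.
- move=> x Sx; apply/cubeP => l; have := Sx l; rewrite /D.
  case: eqP => _; first by rewrite /= in_itv/= ler_norml => /andP[h1 h2]; apply/andP; split; lra.
  rewrite ler_norml; case: eqP => _; last by rewrite /= in_itv/= => /andP[h1 h2]; apply/andP; split; lra.
  by move=> []; rewrite /= in_itv/= => /andP[h1 h2]; apply/andP; split; lra.
- apply: (@two_maps_setting R k n i0 j0 t ij t0 kt1 S _ rho f g
    [set p; - p] [set - p'; p'] mu) => //.
  + exact: compact_cube.
  + by apply/cubeP => l; rewrite mxE normr0.
  + exact: closed_pair.
  + exact: closed_pair.
  + by move=> _ [->|->]; [|apply: cubeN]; apply: cube_p; left.
  + by move=> _ [->|->]; [apply: cubeN|]; apply: cube_p; right.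
  + by move=> x; rewrite /f; case: ifP; [left|right].
  + by move=> x; rewrite /g; case: ifP; [left|right].
  move=> x a b Sx aE bE.
  have x0 : - t <= x ord0 l0 <= t by have := Sx l0; rewrite /D eqxx /= in_itv.
  have x1 : up x /\ 2^-1 <= x ord0 l1 \/ ~~ up x /\ x ord0 l1 <= - 2^-1.
    have := Sx l1; rewrite /D l10 eqxx /up -leNgt => -[]; rewrite /= in_itv/= => /andP[h1 h2].
      by right; split; lra.
    by left; split; lra.
  have key (y : R) : 2^-1 <= y -> t * (1 - (6 * t) ^+ 2) + (1 - k%:R * t) * t <=
      (1 - k%:R * t) * (6 * t * y) by exact: slab_gain.
  have esqN (v : 'rV[R]_n) : esq (- v) = esq v by rewrite /esq edotNl edotNr opprK.
  have cost1 : two_cost k t x p (- p') =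
      (1 - t) * (1 + (6 * t) ^+ 2) - 2 * ((1 - k%:R * t) * (6 * t * x ord0 l1))
      + t * (1 - (6 * t) ^+ 2).
    by rewrite /two_cost esqN pp pp' !edotDr !edotNr xp xp' p_p'; field.
  have cost2 : two_cost k t x (- p) p' =
      (1 - t) * (1 + (6 * t) ^+ 2) + 2 * ((1 - k%:R * t) * (6 * t * x ord0 l1))
      + t * (1 - (6 * t) ^+ 2).
    by rewrite /two_cost esqN pp pp' edotNl !edotDr !edotNr xp xp' p_p'; field.
  have cost3 : two_cost k t x p p' =
      (1 - t) * (1 + (6 * t) ^+ 2) - 2 * ((1 - k%:R * t) * x ord0 l0)
      - t * (1 - (6 * t) ^+ 2).
    by rewrite /two_cost pp pp' !edotDr xp xp' p_p'; field.
  have cost4 : two_cost k t x (- p) (- p') =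
      (1 - t) * (1 + (6 * t) ^+ 2) + 2 * ((1 - k%:R * t) * x ord0 l0)
      - t * (1 - (6 * t) ^+ 2).
    by rewrite /two_cost !esqN pp pp' edotNl !edotDr !edotNr xp xp' p_p'; field.
  have w0 : 0 <= 1 - k%:R * t by rewrite subr_ge0 (le_trans kt1)//; lra.
  have x0u : (1 - k%:R * t) * x ord0 l0 <= (1 - k%:R * t) * t.
    by rewrite ler_wpM2l//; case/andP: x0.
  have x0l : - ((1 - k%:R * t) * t) <= (1 - k%:R * t) * x ord0 l0.
    by rewrite -mulrN ler_wpM2l//; case/andP: x0.
  have b0 : 0 <= t * (1 - (6 * t) ^+ 2).
    by rewrite mulr_ge0 ?(ltW t0)// subr_ge0 expr_le1//; lra.
  have wt0 : 0 <= (1 - k%:R * t) * t by rewrite mulr_ge0// ltW.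
  have key_up : 2^-1 <= x ord0 l1 -> t * (1 - (6 * t) ^+ 2) + (1 - k%:R * t) * t <=
      (1 - k%:R * t) * (6 * t * x ord0 l1) by exact: key.
  have key_down : x ord0 l1 <= - 2^-1 -> t * (1 - (6 * t) ^+ 2) + (1 - k%:R * t) * t <=
      - ((1 - k%:R * t) * (6 * t * x ord0 l1)).
    by move=> xl; have := key (- x ord0 l1); rewrite !mulrN lerNr; apply.
  rewrite /f /g; move: cost1 cost2 cost3 cost4 key_up key_down wt0 b0 x0u x0l.
  set M := (1 - t) * _; set X0 := _ * x ord0 l0; set B := t * _.
  set X1 := _ * (6 * t * x ord0 l1); set WT := _ * t.
  move: M X0 B X1 WT => M X0 B X1 WT c1 c2 c3 c4.
  case: x1 => -[ux x1]; [move=> /(_ x1) + _|move=> _ /(_ x1)].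
    by rewrite ux; case: aE => ->; case: bE => ->; rewrite ?c1 ?c2 ?c3 ?c4; lra.
  by rewrite (negbTE ux); case: aE => ->; case: bE => ->;
    rewrite ?c1 ?c2 ?c3 ?c4; lra.
- rewrite /T two_maps_i two_maps_j// L2_distE.
  have -> : (\int[rho]_x (esq ((f x : 'rV[R]_n) - g x))%:E = (2 ^+ 2)%:E)%E.
    rewrite (eq_integral (fun=> (2 ^+ 2)%:E)) => [|x _].
      by rewrite integral_cst// [X in (_ * X)%E](probability_setT rho) mule1.
    have e4 : esq (p + p') = 2 ^+ 2.
      by rewrite /esq !edotE -!/(esq _) pp pp' (edotC p') p_p'; ring.
    congr EFin; rewrite /f /g; case: ifP => _; first by rewrite opprK.
    by rewrite -opprD /esq edotNl edotNr opprK.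
  by rewrite poweR_EFin powR12_sqrt ?sqr_ge0// sqrtr_sqr ger0_norm.
(* By symmetry [h] has the law of [g], but it is close to [f]. *)
pose h (x : borelRn R n) : borelRn R n := if up x then p' else - p'.
have mh : measurable_fun setT h by apply: measurable_fun_ifT.
apply: le_trans (wasserstein1_le_maps mf mh _ _) _.
- by move=> A _; rewrite muE /T two_maps_i.
- move=> A _; rewrite muE /T two_maps_j//.
  exact: (same_law_halves mup rho_up (- p') p').
rewrite (eq_integral (fun=> (12 * t)%:E)) => [|x _].
  by rewrite integral_cst// [X in (_ * X)%E](probability_setT rho) mule1.
have e12 : esq (p - p') = (12 * t) ^+ 2.
  by rewrite /esq !edotE -!/(esq _) pp pp' (edotC p') p_p'; ring.
have esqpp : esq ((f x : 'rV[R]_n) - h x) = (12 * t) ^+ 2.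
  rewrite /f /h; case: ifP => _; first exact: e12.
  by rewrite -opprD /esq edotNl edotNr opprK.
by rewrite eucl_distE esqpp sqrtr_sqr ger0_norm// mulr_ge0// ltW.
Qed.

End second_example.

(** * Optimality of the exponents *)

Section refutation.
Variables (R : realType) (k n : nat).
Hypothesis k2 : (2 <= k)%N.

Let i0 : 'I_k := Ordinal (leq_trans (isT : (1 <= 2)%N) k2).
Let j0 : 'I_k := Ordinal k2.

Let ij : i0 != j0.
Proof. by []. Qed.

Lemma mule_poweR_le (c w alpha : R) (W : \bar R) : 0 <= alpha ->
  (0 <= W)%E -> (W <= w%:E)%E -> (c%:E * W `^ alpha <= (`|c| * w `^ alpha)%:E)%E.
Proof.
move=> a0 W0 Ww; apply: le_trans (_ : `|c|%:E * W `^ alpha <= _)%E.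
  by apply: lee_wpmul2r; [exact: poweR_ge0|rewrite lee_fin ler_norm].
rewrite EFinM -poweR_EFin; apply: lee_wpmul2l; first by rewrite lee_fin.
exact: le_poweR.
Qed.

Lemma no_power_bound (alpha c0 c1 : R) : 2^-1 < alpha -> 0 < c0 ->
  ~ (forall e, 0 < e -> e <= 2^-1 -> c0 * e `^ 2^-1 <= c1 * e `^ alpha).
Proof.
move=> a2 c00 h; have a20 : 0 < alpha - 2^-1 by rewrite subr_gt0.
have h0 : 0 < 2^-1 :> R by [].
have [e [e0 e2 ce]] := small_power c1 c00 a20 h0.
have := h e e0 e2; rewrite leNgt => /negP; apply.
have -> : alpha = (alpha - 2^-1) + 2^-1 by rewrite subrK.
rewrite powRD; last by apply/implyP => _; rewrite gt_eqF.
by rewrite mulrA ltr_pM2r// powR_gt0.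
Qed.

Lemma union_cube (S : set 'rV[R]_n) : S `<=` @cube R n 2 -> S `|` @cube R n 2 = @cube R n 2.
Proof. by move=> SC; rewrite setUidr. Qed.

(** With the transposition of the two distinguished indices, the left-hand side is
at least [t * eps ^ (1/2) / 2], and the sum on the right-hand side is at most
[eps]. *)
Lemma not_permutation_estimate (C : R -> R) (alpha : R) : (1 <= n)%N -> 2^-1 < alpha ->
  ~ permutation_estimate k n C alpha.
Proof.
move=> n1 a2 est.
have t0 := half_weight_gt0 R k2; have kt := half_weight R k2.
set t := (2 * k%:R)^-1 in t0 kt.
pose d := C (eucl_diam (@cube R n 2)).
have a0 : 0 <= alpha by apply: ltW; apply: lt_trans a2.
apply: (@no_power_bound alpha (t / 2) `|d| a2); first by rewrite divr_gt0.
move=> e e0 e2.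
have [S [rho [mu [T [SC setting L2 W]]]]] := first_example (Ordinal n1) ij k2 e0 e2.
have := est _ _ _ _ _ _ (tperm i0 j0) setting (fun i => erefl).
rewrite union_cube// -/d => {}est.
rewrite -lee_fin; apply: le_trans (_ : (t%:E * L2_dist rho (T i0) (T j0)) <= _)%E.
  by rewrite -mulrA EFinM; apply: lee_wpmul2l; rewrite ?lee_fin ?(ltW t0).
have W0 m m' : (0 <= wasserstein1 (mu m) (mu m'))%E by exact: wasserstein1_ge0.
apply: le_trans (le_trans _ est) _.
  rewrite (bigD1 i0)//= tpermL leeDl//; apply: sume_ge0 => m _.
  by rewrite mule_ge0 ?lee_fin ?(ltW t0)// L2_distE poweR_ge0.
apply: mule_poweR_le => //.
  by apply: sume_ge0 => m _; rewrite mule_ge0 ?lee_fin ?(ltW t0).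
apply: le_trans (_ : \sum_(m < k) (t * (2 * e))%:E <= _)%E.
  by apply: lee_sum => m _; rewrite EFinM; apply: lee_wpmul2l; rewrite ?lee_fin ?(ltW t0).
rewrite sumEFin sumr_const card_ord lee_fin -(mulr_natl (t * _)) mulrA kt mulrA mulVf ?mul1r//.
Qed.

Lemma not_pair_estimate (C : R -> R) (alpha : R) : (1 <= n)%N -> 2^-1 < alpha ->
  ~ pair_estimate k n C (- 2^-1) alpha.
Proof.
move=> n1 a2 est.
have t0 := half_weight_gt0 R k2; have kt := half_weight R k2.
set t := (2 * k%:R)^-1 in t0 kt.
pose d := C (eucl_diam (@cube R n 2)) * (t + t) `^ (- 2^-1).
have a0 : 0 <= alpha by apply: ltW; apply: lt_trans a2.
apply: (@no_power_bound alpha 2^-1 (`|d| * 2 `^ alpha) a2) => // e e0 e2.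
have [S [rho [mu [T [SC setting L2 W]]]]] := first_example (Ordinal n1) ij k2 e0 e2.
have := est _ _ _ _ _ _ i0 j0 setting erefl.
rewrite union_cube// equal_weightsS -/d => {}est.
rewrite -lee_fin -mulrA -powRM ?(ltW e0)//.
apply: le_trans (le_trans L2 est) _.
by apply: mule_poweR_le => //; exact: wasserstein1_ge0.
Qed.

Lemma not_pair_estimate_weight (C : R -> R) (beta : R) : (2 <= n)%N -> - 2^-1 < beta ->
  ~ pair_estimate k n C beta 2^-1.
Proof.
move=> n2 b2 est.
pose l0 : 'I_n := Ordinal (leq_trans (isT : (1 <= 2)%N) n2).
pose l1 : 'I_n := Ordinal n2.
have l01 : l0 != l1 by [].
pose d := C (eucl_diam (@cube R n 2)).
have b20 : 0 < beta + 2^-1 by rewrite -ltrBlDr sub0r.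
have k0 : 0 < k%:R :> R by rewrite ltr0n (leq_trans _ k2).
have e0 : 0 < (12 * k%:R)^-1 :> R by rewrite invr_gt0 mulr_gt0.
have [t [t0 te ct]] := small_power (`|d| * 2 `^ beta * 12 `^ 2^-1) (ltr0Sn R 1) b20 e0.
have kt : k%:R * t <= 12^-1.
  apply: le_trans (ler_wpM2l (ltW k0) te) _.
  by rewrite invfM mulrCA divff ?mulr1// gt_eqF.
have t12 : t <= 12^-1.
  by apply: le_trans kt; rewrite ler_peMl ?(ltW t0)// ler1n (leq_trans _ k2).
have [S [rho [mu [T [SC setting L2 W]]]]] := second_example ij l01 t0 kt t12.
have := est _ _ _ _ _ _ i0 j0 setting erefl.
rewrite union_cube// equal_weightsS L2 -/d => {}est.
have := le_trans est (mule_poweR_le (d * (t + t) `^ beta) _ (wasserstein1_ge0 _ _) W).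
rewrite invr_ge0 => /(_ (ler0n _ _)); rewrite lee_fin leNgt => /negP; apply.
apply: le_lt_trans ct; rewrite normrM (ger0_norm (powR_ge0 _ _)).
rewrite -mulr2n -(mulr_natl t 2) !powRM ?(ltW t0)//.
rewrite powRD; last by apply/implyP => _; rewrite gt_eqF.
by rewrite le_eqVlt; apply/orP; left; apply/eqP; ring.
Qed.

End refutation.

Theorem theorem1p7 (R : realType) :
  (exists C : nat -> R -> R,
     (forall N D, 0 < C N D) /\
     forall k n : nat, (3 <= k.+1)%N -> (1 <= n)%N ->
       permutation_estimate k n (C k.+1) (2^-1) /\
       pair_estimate k n (C k.+1) (- 2^-1) (2^-1)) /\
  (forall (k n : nat) (alpha : R),
     (3 <= k.+1)%N -> (1 <= n)%N -> 2^-1 < alpha ->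
     ~ (exists C : R -> R, permutation_estimate k n C alpha) /\
     ~ (exists C : R -> R, pair_estimate k n C (- 2^-1) alpha)) /\
  (forall (k n : nat) (beta : R),
     (3 <= k.+1)%N -> (2 <= n)%N -> - 2^-1 < beta ->
     ~ (exists C : R -> R, pair_estimate k n C beta (2^-1))).
Proof.
split; last split.
- exists (@stability_constant R); split=> [N D|k n _ n1]; first exact: stability_constant_gt0.
  by split; [exact: stability_permutation|exact: stability_pair].
- by move=> k n alpha k2 n1 a2; split=> -[C];
    [exact: not_permutation_estimate|exact: not_pair_estimate].
- by move=> k n beta k2 n2 b2 [C]; exact: not_pair_estimate_weight.
Qed.
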